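(* Let $X(\Sigma)$ be a smooth projective toric variety and let $\mathcal{E}$ be a toric vector bundle of rank $r$ over $X(\Sigma)$ given by a pair $(L,D)$, with $\mathcal{R}(\mathbb{P}\mathcal{E})$ generated in $\mathrm{Sym}$-degree $1$. Suppose that there is a maximal flag of flats $F_1\subset\cdots\subset F_r$ in the matroid $\mathcal{M}(L)$ such that, for the corresponding maximal face $K$ of the Bergman fan $\mathrm{Trop}(L)$, the inverse image $C_K$ of $K$ in $\mathrm{Trop}(\mathcal{I})$ is a prime cone of $\mathrm{Trop}(\mathcal{I})$. Let \[M=\begin{bmatrix} D & -I\\ E_K & 0\end{bmatrix}.\] Then: (1) $\Delta = M\cdot \mathbb{Q}_{\ge 0}^{m+n}$ is a global Newton-Okounkov body of $\mathbb{P}\mathcal{E}$ (with respect to the valuation $\mathfrak{v}_M$); (2) for every $(\alpha,\beta)\in \mathrm{CL}(\mathbb{P}\mathcal{E})\cong \mathrm{CL}(X(\Sigma))\times\mathbb{Z}$, $\Delta_{\alpha,\beta}=M\cdot P_{\alpha,\beta}$ is the Newton-Okounkov body of $(\alpha,\beta)$ (with respect to $\mathfrak{v}_M$).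
   Context: Toric setup: $\Sigma$ is a complete smooth fan in $N\otimes\mathbb{Q}$, $N\cong\mathbb{Z}^d$, with rays $\rho_1,\dots,\rho_n$; $X(\Sigma)$ is the associated toric variety over $\mathbb{C}$, with torus $T$; $\mathbf{e}_i\in\mathrm{CL}(X(\Sigma))$ is the class of the toric prime divisor of $\rho_i$. Linear ideals: $L\subset\mathbb{C}[y_1,\dots,y_m]$ is an ideal generated by homogeneous linear forms. For a weight $w$, $\mathrm{in}_w(f)$ is the sum of the terms of $f$ of minimal $w$-weight, $\mathrm{in}_w$ of an ideal is generated by the $\mathrm{in}_w(f)$, and $\mathrm{Trop}$ of an ideal is the set of rational $w$ such that $\mathrm{in}_w$ of the ideal contains no monomial. $\mathcal{M}(L)$ is the matroid on $\{y_1,\dots,y_m\}$ in which a set is independent iff no nonzero linear form of $L$ is supported on it. For a basis $\mathbb{B}$, the apartment $A_{\mathbb{B}}\subset\mathrm{Trop}(L)$ is the set of $w\in\mathrm{Trop}(L)$ such that for every $j$, $w_j$ is the minimum of the $w_k$ over those $y_k\in\mathbb{B}$ occurring in the expression of $y_j$ (modulo $L$) in the basis $\mathbb{B}$. Toric vector bundles from $(L,D)$: $\mathbb{C}[y_1,\dots,y_m]/L$ has dimension $r$, and the diagram $D$ is an integral $n\times m$ matrix whose $i$-th row $w_i$ lies in $\mathrm{Trop}(L)$ and such that for each $\sigma\in\Sigma$ the rows $w_i$ with $\rho_i\in\sigma(1)$ lie in a common apartment. $\mathcal{E}$ is the toric vector bundle whose Klyachko data are: the fiber $E$ over the identity of $T$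 is the degree one part of $\mathbb{C}[y]/L$, and $F^{\rho_i}_s\subset E$ is the span of the $y_j$ with $D_{ij}\ge s$. $D_j$ is the $j$-th column of $D$ and $\mathbf{d}_j=\sum_i D_{ij}\mathbf{e}_i$. Cox ring: $\mathbb{P}\mathcal{E}=\mathrm{Proj}_{X(\Sigma)}\bigoplus_\ell \mathrm{Sym}^\ell(\mathcal{E})$, $\pi:\mathbb{P}\mathcal{E}\to X(\Sigma)$, $r\ge 2$, $\mathrm{CL}(\mathbb{P}\mathcal{E})\cong\mathrm{CL}(X(\Sigma))\times\mathbb{Z}$, and $\mathcal{R}(\mathbb{P}\mathcal{E})=\bigoplus_{\mathcal{L},\ell}H^0(X(\Sigma),\mathcal{L}\otimes\mathrm{Sym}^\ell(\mathcal{E}))$, realized inside $\mathrm{Sym}(E)[t_1^{\pm},\dots,t_n^{\pm}]$ with $\mathrm{Sym}(E)=\mathbb{C}[y]/L$. $\mathcal{I}$ is the kernel of $\mathbb{C}[X_1,\dots,X_n,Y_1,\dots,Y_m]\to\mathrm{Sym}(E)[t^{\pm}]$, $X_i\mapsto t_i^{-1}$, $Y_j\mapsto y_jt^{D_j}$. $X_i$ is a section of $\pi^*\mathcal{O}(\mathbf{e}_i)$ and $Y_j$ a section of $\pi^*\mathcal{O}(-\mathbf{d}_j)\otimes\mathcal{O}_{\mathcal{E}}(1)$. ''Generated in $\mathrm{Sym}$-degree $1$'' means that $\mathcal{R}(\mathbb{P}\mathcal{E})$ is generated by its components with $\ell\in\{0,1\}$; then $(L,D)$ is taken such that the $X_i,Y_j$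 generate it, so $\mathcal{R}(\mathbb{P}\mathcal{E})=\mathbb{C}[X,Y]/\mathcal{I}$. Faces and prime cones: a maximal face $K$ of the Bergman fan corresponds to a maximal flag of nonempty flats $F_1\subset\cdots\subset F_r=\{y_1,\dots,y_m\}$: it is the set of vectors $\sum_i c_i\mathbf{e}_{F_i}$ with $c_i\ge 0$ for $i<r$ and $c_r\in\mathbb{Q}$, where $\mathbf{e}_{F}$ is the $0/1$ indicator vector of $F$. $E_K$ is the $r\times m$ matrix with rows $\mathbf{e}_{F_i}$. Weights on $\mathbb{C}[X,Y]$ are written $(v,x)\in\mathbb{Q}^m\times\mathbb{Q}^n$ ($Y$-coordinates first). The map $\phi(v,c)=\big((v_j+\langle c,D_j\rangle)_j,\,-c\big)$ is a bijection $\mathrm{Trop}(L)\times\mathbb{Q}^n\to\mathrm{Trop}(\mathcal{I})$, and $C_K=\phi(K\times\mathbb{Q}^n)$. A cone of $\mathrm{Trop}(\mathcal{I})$ is prime if all points of its relative interior define the same initial ideal of $\mathcal{I}$ and this ideal is prime. Newton-Okounkov bodies: order $\mathbb{Z}^{n+r}$ lexicographically; for $0\neq f\in\mathcal{R}(\mathbb{P}\mathcal{E})$ let $\mathfrak{v}_M(f)$ be the maximum, over polynomials $p\in\mathbb{C}[X,Y]$ representing $f$, of the minimum of $M\cdot u$ over exponent vectors $u$ ($Y$-exponents first) of monomials of $p$. Under the hypotheses this is a discrete valuation of rank $n+r$. The global Newton-Okounkov body is the closed convex cone generated by the values of $\mathfrak{v}_M$ on nonzero elements of $\mathcal{R}(\mathbb{P}\mathcal{E})$.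 The Newton-Okounkov body of $(\alpha,\beta)$, the class of $\mathcal{O}(\alpha,\beta)=\pi^*\mathcal{O}(\alpha)\otimes\mathcal{O}_{\mathcal{E}}(\beta)$, is the closed convex hull of $\bigcup_{k\ge1}\frac1k\,\mathfrak{v}_M\big(H^0(\mathbb{P}\mathcal{E},\mathcal{O}(k\alpha,k\beta))\setminus\{0\}\big)$. Finally \[P_{\alpha,\beta}=\Big\{(a,b)\in\mathbb{Q}_{\ge0}^{n}\times\mathbb{Q}_{\ge0}^{m}\ \Big|\ \sum_j b_j=\beta,\ \sum_j b_j\mathbf{d}_j+\alpha=\sum_i a_i\mathbf{e}_i\ \text{in }\mathrm{CL}(X(\Sigma))\otimes\mathbb{Q}\Big\},\] and $M$ acts on $(a,b)$ through the vector with $b$ in the first $m$ coordinates and $a$ in the last $n$. *)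

(* Defs.v *)
From HB Require Import structures.
From mathcomp Require Import all_boot all_order all_algebra.
From mathcomp Require Import finmap ring_quotient generic_quotient.
From mathcomp Require Import boolp classical_sets reals complex.
From mathcomp Require Import -(notations) monalg.
From mathcomp Require Import mpoly.

Set Implicit Arguments.
Unset Strict Implicit.
Unset Printing Implicit Defensive.

Import Order.TTheory GRing.Theory Num.Theory.
Local Open Scope classical_set_scope.
Local Open Scope ring_scope.

Section Ideals.
Context (S : comNzRingType).

Definition ideal_gen (G : set S) : set S :=
  [set x | exists s : seq (S * S),
     (forall cg, cg \in s -> G cg.2) /\ x = \sum_(cg <- s) cg.1 * cg.2].

Definition prime_ideal (I : set S) : Prop :=
  ~ I 1 /\ forall p q, I (p * q) -> I p \/ I q.

Lemma ideal_gen0 (G : set S) : ideal_gen G 0.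
Proof. by exists [::]; split=> //; rewrite big_nil. Qed.

Lemma ideal_genD (G : set S) x y :
  ideal_gen G x -> ideal_gen G y -> ideal_gen G (x + y).
Proof.
move=> [s [sG ->]] [t [tG ->]]; exists (s ++ t); split; last by rewrite big_cat.
by move=> cg; rewrite mem_cat => /orP[/sG|/tG].
Qed.

Lemma ideal_genM (G : set S) a x : ideal_gen G x -> ideal_gen G (a * x).
Proof.
move=> [s [sG ->]]; exists [seq (a * cg.1, cg.2) | cg <- s]; split.
  by move=> _ /mapP[cg /sG ? ->].
by rewrite big_map mulr_sumr; apply: eq_bigr => cg _; rewrite mulrA.
Qed.
End Ideals.

Section Tropical.
Context (C : fieldType) (k : nat).
Implicit Types (w : 'rV[rat]_k) (u : 'X_{1..k}) (I : set {mpoly C[k]}).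

Definition weight w u : rat := \sum_(i < k) w ord0 i * (u i)%:R.

Definition in_form w (f : {mpoly C[k]}) : {mpoly C[k]} :=
  \sum_(u <- msupp f | all (fun u' => weight w u <= weight w u') (msupp f))
     f@_u *: 'X_[u].

Definition in_ideal w I : set {mpoly C[k]} := ideal_gen [set in_form w f | f in I].

Definition Trop I : set 'rV[rat]_k :=
  [set w | ~ exists u, in_ideal w I 'X_[u]].
End Tropical.

(* Hulls, closure and relative interior are taken inside the rational matrix
   space, with its usual topology. *)
Section Convex.
Context (p q : nat).
Local Notation V := 'M[rat]_(p, q).
Implicit Types X : set V.

Definition aff_hull X : set V :=
  [set x | exists s : seq (rat * V),
     [/\ forall cv, cv \in s -> X cv.2, \sum_(cv <- s) cv.1 = 1
       & x = \sum_(cv <- s) cv.1 *: cv.2]].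

Definition conv_hull X : set V :=
  [set x | exists s : seq (rat * V),
     [/\ forall cv, cv \in s -> 0 <= cv.1 /\ X cv.2, \sum_(cv <- s) cv.1 = 1
       & x = \sum_(cv <- s) cv.1 *: cv.2]].

Definition cone_hull X : set V :=
  [set x | exists s : seq (rat * V),
     (forall cv, cv \in s -> 0 <= cv.1 /\ X cv.2)
     /\ x = \sum_(cv <- s) cv.1 *: cv.2].

Definition Qball (x : V) (e : rat) : set V :=
  [set y | forall i j, `|y i j - x i j| < e].

Definition Qclosure X : set V :=
  [set x | forall e, 0 < e -> exists2 y, X y & Qball x e y].

Definition relint X : set V :=
  [set x | X x /\ exists2 e, 0 < e & aff_hull X `&` Qball x e `<=` X].
End Convex.

Definition ratmx p q (B : 'M[int]_(p, q)) : 'M[rat]_(p, q) := map_mx intr B.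

Definition prime_cone (C : fieldType) (k : nat) (I : set {mpoly C[k]})
    (X : set 'rV[rat]_k) : Prop :=
  [/\ X `<=` Trop I,
      forall w w', relint X w -> relint X w' -> in_ideal w I = in_ideal w' I
    & forall w, relint X w -> prime_ideal (in_ideal w I)].

(* A simplicial fan with rays rho_i, i < n, is given by the matrix [u] whose
   i-th row is the primitive generator of rho_i and by the set [Sigma] of the
   sets of (indices of) rays of its cones. *)
Section Fan.
Context (n d : nat) (u : 'M[int]_(n, d)) (Sigma : {set {set 'I_n}}).

Definition cone (s : {set 'I_n}) : set 'rV[rat]_d :=
  [set x | exists c : 'I_n -> rat,
     (forall i, 0 <= c i) /\ x = \sum_(i in s) c i *: row i (ratmx u)].

Definition is_fan : Prop :=
  [/\ finset.set0 \in Sigma,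
      forall i, [set i]%SET \in Sigma,
      forall s t : {set 'I_n}, s \in Sigma -> t \subset s -> t \in Sigma
    & forall s t, s \in Sigma -> t \in Sigma ->
        cone s `&` cone t = cone (s :&: t)].

(* The rows of B are a basis of Z^d. *)
Definition smooth_fan : Prop :=
  forall s, s \in Sigma ->
    exists (B : 'M[int]_d) (f : 'I_n -> 'I_d),
      [/\ B \in unitmx, {in s &, injective f}
        & forall i, i \in s -> row (f i) B = row i u].

Definition complete_fan : Prop :=
  forall x : 'rV[rat]_d, exists2 s, s \in Sigma & cone s x.

(* X(Sigma) has an ample divisor: by the toric ampleness criterion,
   sum_i a_i D_i is ample iff its support function is strictly convex, i.e. its
   local equation at every maximal cone s satisfies the conditions below. *)
Definition projective_fan : Prop :=
  exists a : 'rV[int]_n, forall s, s \in Sigma -> #|s| = d ->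
    exists chi : 'rV[int]_d, forall i : 'I_n,
      let chi_i := (chi *m u^T) ord0 i in
      if i \in s then chi_i = - a ord0 i else - a ord0 i < chi_i.
End Fan.

(* L is generated by the linear forms sum_j A_ij y_j. *)
Section LinearIdeal.
Context (C : fieldType) (l m : nat) (A : 'M[C]_(l, m)).

Definition linform (c : 'rV[C]_m) : {mpoly C[m]} :=
  \sum_(j < m) c ord0 j *: 'X_j.

Definition lin_ideal : set {mpoly C[m]} :=
  ideal_gen [set linform (row i A) | i in [set: 'I_l]].

Definition lin_idealb : {pred {mpoly C[m]}} := fun p => `[< lin_ideal p >].

Lemma lin_ideal_eval0 p : lin_ideal p -> p.@[fun=> 0] = 0.
Proof.
move=> [s [sL ->]]; rewrite raddf_sum big_seq big1 //= => cg /sL[i _ <-].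
rewrite mevalM [X in _ * X](_ : _ = 0) ?mulr0 // raddf_sum big1 //= => j _.
by rewrite mevalZ mevalXU mulr0.
Qed.

Lemma lin_idealb_closed : idealr_closed lin_idealb.
Proof.
split.
- by apply/asboolP; exact: ideal_gen0.
- apply/asboolP => /lin_ideal_eval0 /eqP.
  by rewrite meval1 oner_eq0.
- move=> a x y /asboolP xL /asboolP yL; apply/asboolP.
  by apply: ideal_genD => //; exact: ideal_genM.
Qed.

HB.instance Definition _ := isIdealr.Build {mpoly C[m]} lin_idealb lin_idealb_closed.

(* Sym(E) = C[y] / L *)
Definition SymE : comNzRingType := {ideal_quot lin_idealb}.

Definition toSym (p : {mpoly C[m]}) : SymE := \pi_({ideal_quot lin_idealb})%qT p.

(* dim E: the degree one part of L is the row space of A *)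
Definition dimE : nat := (m - \rank A)%N.

Definition supported (c : 'rV[C]_m) (B : {set 'I_m}) : Prop :=
  forall j, c ord0 j != 0 -> j \in B.

Definition indep (B : {set 'I_m}) : Prop :=
  forall c, lin_ideal (linform c) -> supported c B -> linform c = 0.

Definition basis (B : {set 'I_m}) : Prop :=
  indep B /\ forall B', indep B' -> B \subset B' -> B' = B.

Definition mrank (S : {set 'I_m}) : nat :=
  \max_(B : {set 'I_m} | (B \subset S) && `[< indep B >]) #|B|.

Definition flat (F : {set 'I_m}) : Prop :=
  forall j, j \notin F -> (mrank F < mrank (j |: F))%N.

Definition apartment (B : {set 'I_m}) : set 'rV[rat]_m :=
  [set w | Trop lin_ideal w /\
     forall j (c : 'rV[C]_m), supported c B -> lin_ideal ('X_j - linform c) ->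
       (exists2 k, c ord0 k != 0 & w ord0 k = w ord0 j)
       /\ forall k, c ord0 k != 0 -> w ord0 j <= w ord0 k].

(* F_1 < ... < F_r are the values of F at 0, ..., r - 1. *)
Definition maximal_flag (r : nat) (F : 'I_r -> {set 'I_m}) : Prop :=
  [/\ forall i, flat (F i) /\ F i != finset.set0,
      forall i j : 'I_r, (i < j)%N -> F i \proper F j,
      forall i : 'I_r, i.+1 = r -> F i = [set: 'I_m]%SET
    & forall G, flat G -> G != finset.set0 ->
        (forall i, G \subset F i \/ F i \subset G) -> exists i, G = F i].
End LinearIdeal.

Section Face.
Context (m r : nat) (F : 'I_r -> {set 'I_m}).

Definition EK : 'M[int]_(r, m) := \matrix_(i, j) (j \in F i)%:R.

Definition face : set 'rV[rat]_m :=
  [set v | exists c : 'rV[rat]_r,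
     (forall i : 'I_r, (i.+1 < r)%N -> 0 <= c ord0 i) /\ v = c *m ratmx EK].
End Face.

(* The Laurent polynomial ring S[t_1^+-, ..., t_n^+-].
   Elements are finitely supported functions on Z^n; [monalg] only provides the
   ring structure for monoids of exponents without units. *)
Definition laurent (S : comNzRingType) (n : nat) : Type :=
  monalg.malg 'rV[int]_n S.

Section Laurent.
Context (S : comNzRingType) (n : nat).
Local Notation K := 'rV[int]_n.
Local Notation T := (laurent S n).

HB.instance Definition _ := GRing.Zmodule.copy T (monalg.malg K S).

(* the coefficient of t^w *)
Definition lcoef (f : T) (w : K) : S := monalg.mcoeff w f.
(* s t^w *)
Definition lmon (s : S) (w : K) : T := monalg.mkmalgU w s.
Definition lsupp (f : T) : {fset K} := monalg.msupp f.
Definition lone : T := lmon 1 0.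
Definition lmul (f g : T) : T :=
  \sum_(v <- lsupp f) \sum_(w <- lsupp g) lmon (lcoef f v * lcoef g w) (v + w).

Local Lemma lmon0 w : lmon 0 w = 0. Proof. exact: monalg.monalgU0. Qed.
Local Lemma lmonD w : {morph lmon^~ w : x y / x + y}.
Proof. exact: monalg.monalgUD. Qed.
Local Lemma lE (f : T) : f = \sum_(w <- lsupp f) lmon (lcoef f w) w.
Proof. exact: monalg.monalgE. Qed.
Local Lemma lcoefD (f g : T) w : lcoef (f + g) w = lcoef f w + lcoef g w.
Proof. exact: monalg.mcoeffD. Qed.
Local Lemma lcoefUU s w : lcoef (lmon s w) w = s.
Proof. exact: monalg.mcoeffUU. Qed.
Local Lemma lsuppU s w : (lsupp (lmon s w) `<=` [fset w])%fset.
Proof. exact: monalg.msuppU_le. Qed.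

Local Lemma lmulw (d1 d2 : {fset K}) (f g : T) :
    (lsupp f `<=` d1)%fset -> (lsupp g `<=` d2)%fset ->
  lmul f g = \sum_(v <- d1) \sum_(w <- d2) lmon (lcoef f v * lcoef g w) (v + w).
Proof.
move=> le1 le2; rewrite /lmul (big_fset_incl _ le1) /=.
  apply/eq_bigr=> v _; apply/big_fset_incl => // w _ /monalg.mcoeff_outdom gw.
  by rewrite /lcoef gw mulr0 lmon0.
move=> v _ /monalg.mcoeff_outdom fv.
by rewrite big1 // => w _; rewrite /lcoef fv mul0r lmon0.
Qed.

Local Lemma lmulC : commutative lmul.
Proof.
move=> f g; rewrite /lmul exchange_big /=; apply: eq_bigr => v _.
by apply: eq_bigr => w _; rewrite mulrC addrC.
Qed.

Local Lemma lmul0 (g : T) : lmul 0 g = 0.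
Proof. by rewrite /lmul /lsupp monalg.msupp0 big_seq_fset0. Qed.

Local Lemma lmulUU a b v w : lmul (lmon a v) (lmon b w) = lmon (a * b) (v + w).
Proof. by rewrite (lmulw (lsuppU _ _) (lsuppU _ _)) !big_seq_fset1 !lcoefUU. Qed.

Local Lemma lmulUl a v g :
  lmul (lmon a v) g = \sum_(w <- lsupp g) lmon (a * lcoef g w) (v + w).
Proof.
rewrite (lmulw (lsuppU _ _) (fsubset_refl _)) big_seq_fset1.
by apply/eq_bigr => w _; rewrite lcoefUU.
Qed.

Local Lemma lmul1 : left_id lone lmul.
Proof.
move=> g; rewrite lmulUl [RHS]lE; apply: eq_bigr => w _.
by rewrite mul1r add0r.
Qed.

Local Lemma lmulDl : left_distributive lmul +%R.
Proof.
move=> f1 f2 g.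
rewrite (lmulw (monalg.msuppD_le f1 f2) (fsubset_refl (lsupp g))).
rewrite [lmul f1 g](lmulw (fsubsetUl _ (lsupp f2)) (fsubset_refl (lsupp g))).
rewrite [lmul f2 g](lmulw (fsubsetUr (lsupp f1) _) (fsubset_refl (lsupp g))).
rewrite -big_split /=; apply/eq_bigr=> v _.
rewrite -big_split /=; apply/eq_bigr=> w _.
by rewrite lcoefD mulrDl lmonD.
Qed.

Local Lemma lmulDr : right_distributive lmul +%R.
Proof. by move=> g f1 f2; rewrite !(lmulC g) lmulDl. Qed.

Local Lemma lmulEl f g : lmul f g = \sum_(v <- lsupp f) lmul (lmon (lcoef f v) v) g.
Proof. by apply: eq_bigr => v _; rewrite lmulUl. Qed.

Local Lemma lmulEr f g : lmul f g = \sum_(v <- lsupp g) lmul f (lmon (lcoef g v) v).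
Proof. by rewrite lmulC lmulEl; apply: eq_bigr => v _; rewrite lmulC. Qed.

Local Lemma lmulr0 (g : T) : lmul g 0 = 0.
Proof. by rewrite lmulC lmul0. Qed.

Local Lemma lmulA : associative lmul.
Proof.
move=> f g h.
rewrite [lmul f g]lmulEl.
rewrite [RHS](big_morph (lmul^~ _) (fun _ _ => lmulDl _ _ _) (lmul0 _)).
rewrite lmulEl; apply/eq_bigr=> k1 _.
rewrite [lmul g h]lmulEl [lmul _ g]lmulEr.
rewrite [LHS](big_morph (lmul _) (fun _ _ => lmulDr _ _ _) (lmulr0 _)).
rewrite [RHS](big_morph (lmul^~ _) (fun _ _ => lmulDl _ _ _) (lmul0 _)).
apply/eq_bigr=> k2 _; rewrite lmulUU.
rewrite [lmul _ h]lmulEr [RHS]lmulEr.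
rewrite [LHS](big_morph (lmul _) (fun _ _ => lmulDr _ _ _) (lmulr0 _)).
by apply/eq_bigr=> k3 _; rewrite !lmulUU mulrA addrA.
Qed.

Local Lemma lone_neq0 : lone != 0.
Proof.
apply/eqP => /(congr1 (fun f : T => lcoef f 0)) /eqP.
by rewrite lcoefUU /lcoef monalg.mcoeff0 oner_eq0.
Qed.

HB.instance Definition _ := GRing.Zmodule_isComNzRing.Build T
  lmulA lmulC lmul1 lmulDl lone_neq0.
End Laurent.

Section Cox.
Context (C : fieldType) (n d l m : nat).
Context (u : 'M[int]_(n, d)) (A : 'M[C]_(l, m)) (D : 'M[int]_(n, m)).
Local Notation Sym := (SymE A).
Local Notation LSym := (laurent Sym n).

Definition diagram (Sigma : {set {set 'I_n}}) : Prop :=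
  (forall i, Trop (lin_ideal A) (ratmx (row i D)))
  /\ forall s, s \in Sigma ->
       exists2 B, basis A B & forall i, i \in s -> apartment A B (ratmx (row i D)).

(* the fibre E, i.e. the degree one part of Sym(E) *)
Definition fibre : set Sym := [set x | exists c, x = toSym A (linform c)].

(* the Klyachko filtration F^{rho_i}_s of E *)
Definition klyachko (i : 'I_n) (s : int) : set Sym :=
  [set x | exists2 c : 'rV[C]_m,
     (forall j, c ord0 j != 0 -> s <= D i j) & x = toSym A (linform c)].

Definition span (G : set Sym) : set Sym :=
  [set x | exists t : seq (C * Sym),
     (forall cg, cg \in t -> G cg.2)
     /\ x = \sum_(cg <- t) toSym A cg.1%:MP * cg.2].

(* Sym^b(E), which is 0 for b < 0 *)
Definition sym_pow (b : int) : set Sym :=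
  span [set x | exists es : seq Sym,
     [/\ (size es)%:Z = b, forall e, e \in es -> fibre e
       & x = \prod_(e <- es) e]].

(* the Klyachko filtration of Sym^b(E) induced by that of E *)
Definition sym_klyachko (i : 'I_n) (b s : int) : set Sym :=
  span [set x | exists es : seq (int * Sym),
     [/\ (size es)%:Z = b, forall e, e \in es -> klyachko i e.1 e.2,
         s <= \sum_(e <- es) e.1 & x = \prod_(e <- es) e.2]].

(* H^0(X(Sigma), O(sum_i a_i D_i) (x) Sym^b(E)), by Klyachko's description: the
   sections of weight chi are the elements of Sym^b(E) lying in
   F^{rho_i}_{<chi, u_i> - a_i} for all i.  They are placed in degree t^w with
   w_i = <chi, u_i> - a_i, so that this only depends on the class of
   sum_i a_i D_i in CL(X(Sigma)) = Z^n / { (<chi, u_i>)_i }. *)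
Definition H0 (a : 'rV[int]_n) (b : int) : set LSym :=
  [set f | forall w, lcoef f w != 0 ->
     [/\ exists chi : 'rV[int]_d, w = chi *m u^T - a,
         sym_pow b (lcoef f w)
       & forall i, sym_klyachko i b (w ord0 i) (lcoef f w)]].

Definition cox : set LSym :=
  [set f | exists s : seq LSym,
     (forall g, g \in s -> exists a b, H0 a b g) /\ f = \sum_(g <- s) g].

Definition generated_in_sym_degree1 : Prop :=
  forall f, cox f -> exists ss : seq (seq LSym),
    (forall s g, s \in ss -> g \in s -> exists a, H0 a 0 g \/ H0 a 1 g)
    /\ f = \sum_(s <- ss) \prod_(g <- s) g.

Definition cst (c : C) : LSym := lmon (toSym A c%:MP) 0.

(* C[Y, X] -> Sym(E)[t^+-], X_i |-> t_i^-1 and Y_j |-> y_j t^{D_j}; the first m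
   variables are the Y_j and the last n ones the X_i. *)
Definition psi : {mpoly C[m + n]} -> LSym :=
  mmap cst
       (fun k => match fintype.split k with
                 | inl j => lmon (toSym A 'X_j) (col j D)^T
                 | inr i => lmon 1 (- delta_mx ord0 i)
                 end).

Definition cox_ideal : set {mpoly C[m + n]} := [set p | psi p = 0].

Definition generated_by_XY : Prop := forall f, cox f -> exists p, psi p = f.

(* C_K = phi(K x Q^n), with <c, D_j> = (c *m D)_j *)
Definition CK (K : set 'rV[rat]_m) : set 'rV[rat]_(m + n) :=
  [set x | exists2 v, K v & exists c : 'rV[rat]_n,
     x = row_mx (v + c *m ratmx D) (- c)].

Definition bigM (r : nat) (F : 'I_r -> {set 'I_m}) : 'M[int]_(n + r, m + n) :=
  block_mx D (- 1%:M) (EK F) 0.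

(* (b, a) lies in [P alpha beta] for (a, b) in P_{alpha,beta}; alpha is the
   class of the divisor sum_i alpha_i D_i *)
Definition P (alpha : 'rV[int]_n) (beta : int) : set 'cV[rat]_(m + n) :=
  [set z : 'cV[rat]_(m + n) |
     let b : 'cV[rat]_m := usubmx z in
     let a : 'cV[rat]_n := dsubmx z in
     [/\ forall k, 0 <= z k ord0,
         \sum_(j < m) b j ord0 = beta%:~R
       & exists chi : 'cV[rat]_d,
           ratmx D *m b + (ratmx alpha)^T - a = ratmx u *m chi]].
End Cox.

Arguments H0 {C n d l m} u A D a b.
Arguments cox {C n d l m} u A D.
Arguments cst {C} n {l m} A c.
Arguments klyachko {C n l m} A D i s.

Section Valuation.
Context (N : nat).

Definition lexle (x y : 'cV[int]_N) : bool :=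
  (([tuple x i ord0 | i < N] : N.-tuplelexi int)
     <= ([tuple y i ord0 | i < N] : N.-tuplelexi int))%O.

(* The values of v generate a subgroup of Z^N of rank N; v 0 is irrelevant. *)
Definition full_rank_valuation (C : fieldType) (S : comNzRingType)
    (iota : C -> S) (R : set S) (v : S -> 'cV[int]_N) : Prop :=
  [/\ forall c, c != 0 -> v (iota c) = 0,
      forall f g, R f -> R g -> f != 0 -> g != 0 ->
        f * g != 0 /\ v (f * g) = v f + v g,
      forall f g, R f -> R g -> f != 0 -> g != 0 -> f + g != 0 ->
        lexle (v f) (v (f + g)) || lexle (v g) (v (f + g))
    & exists g : 'I_N -> S, (forall j, R (g j) /\ g j != 0)
        /\ \det (\matrix_(i, j) v (g j) i ord0) != 0].

Definition global_NO_body (S : nmodType) (R : set S) (v : S -> 'cV[int]_N) :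
    set 'cV[rat]_N :=
  Qclosure (cone_hull [set ratmx (v f) | f in [set f | R f /\ f <> 0]]).

Definition NO_body (S : nmodType) (H : nat -> set S) (v : S -> 'cV[int]_N) :
    set 'cV[rat]_N :=
  Qclosure (conv_hull
    [set x | exists k f, [/\ (0 < k)%N, H k f, f <> 0
                           & x = k%:R^-1 *: ratmx (v f)]]).
End Valuation.

Section ValuationM.
Context (C : fieldType) (n l m N : nat).
Context (A : 'M[C]_(l, m)) (D : 'M[int]_(n, m)) (M : 'M[int]_(N, m + n)).

Definition expv (e : 'X_{1..m + n}) : 'cV[int]_(m + n) := \col_k (e k)%:Z.

Definition is_min_value (p : {mpoly C[m + n]}) (x : 'cV[int]_N) : Prop :=
  (exists2 e, e \in msupp p & x = M *m expv e)
  /\ forall e, e \in msupp p -> lexle x (M *m expv e).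

Definition is_val (f : laurent (SymE A) n) (x : 'cV[int]_N) : Prop :=
  (exists2 p, psi A D p = f & is_min_value p x)
  /\ forall p y, psi A D p = f -> is_min_value p y -> lexle y x.

(* v_M(f); the value is irrelevant when the maximum does not exist *)
Definition val_M (f : laurent (SymE A) n) : 'cV[int]_N := xget 0 (is_val f).
End ValuationM.

Arguments is_val {C n l m N} A D M f x.
Arguments val_M {C n l m N} A D M f.

(* Main.v *)
Require Import Defs.
From HB Require Import structures.
From mathcomp Require Import all_boot all_order all_algebra.
From mathcomp Require Import boolp classical_sets reals complex mpoly.
From mathcomp Require finmap monalg.
From mathcomp Require Import zify ring lra.

(** The cone [C_K] consists of the combinations [c *m M] of the rows of [M] whose
    coefficients at the proper flats of the flag are nonnegative; a combination
    with all [c_i > 0] lies in its relative interior.  If in addition the [c_i]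
    decrease fast enough, then on any prescribed finite set of monomials the
    weight [c *m M] induces the lexicographic order of the values [M *m u].  Since
    [C_K] is a prime cone, all these weights have one and the same initial ideal
    [J] of the ideal [I] of relations, and [J] is prime and contains no monomial.
    So [J] acts as the initial ideal of [I] for the lexicographic order itself;
    this is [prime_cone_degeneration].

    Call a polynomial [p] adapted to [x] if no value of its monomials is below
    [x] and the part of [p] of value exactly [x] is not in [J].  Such a [p]
    computes the valuation of its class: a representative of the same class with
    a larger minimum would differ from [p] by a relation whose initial form is
    that part of [p] ([adapted_is_val]).  Every nonzero class has an adapted
    representative: as long as the lowest part of [p] lies in [J], subtract a
    relation with this initial form.  The relations are homogeneous for the torus
    weight and the degree in [y], so that this happens among the finitely many
    monomials that share these degrees with a monomial of [p], and the
    process stops ([subduction_step], [adapted_exists]).  Adapted polynomials are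
    stable under products because [J] is prime ([adaptedM]), which makes the
    valuation additive, and monomials are adapted because [J] contains none, so
    [X^a Y^b] has value [M *m (b, a)].  An element chosen in each step of the
    flag gives a minor of [M] equal to [1] or [-1], whence the rank
    ([bigM_minor]).

    Consequently the values of the sections of class [(alpha, beta)] are values
    of monomials of that class, and all of these occur.  After division by [k]
    the values for the classes [(k alpha, k beta)] fill exactly the rational
    points of [M *m P alpha beta], as every rational point of [P alpha beta]
    becomes integral after a dilation ([P_integral_multiple]).  It remains to see
    that convex hull and closure add nothing: the image of a rational polyhedron
    under a linear map is convex, and it is closed by Fourier-Motzkin elimination
    ([weyl], [Qclosure_polyhedron]). *)

Set Implicit Arguments.
Unset Strict Implicit.
Unset Printing Implicit Defensive.

Import Order.TTheory GRing.Theory Num.Theory.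
Local Open Scope classical_set_scope.
Local Open Scope ring_scope.

(** * Polynomials restricted to a set of monomials, and initial ideals *)

Lemma seq_has_min (T : eqType) (le : rel T) (s : seq T) :
  total le -> transitive le -> s != [::] ->
  exists2 x, x \in s & {in s, forall y, le x y}.
Proof.
move=> tot tr; elim: s => // x [|y s] IHs _.
  exists x; rewrite ?mem_head // => z; rewrite inE => /eqP ->.
  by have := tot x x; rewrite orbb.
have [//|z zs zmin] := IHs.
have [xz|zx] := orP (tot x z).
  exists x; rewrite ?mem_head // => t; rewrite inE => /predU1P[->|/zmin zt].
    by have := tot x x; rewrite orbb.
  exact: tr xz zt.
exists z => [|t]; first by rewrite inE zs orbT.
by rewrite inE => /predU1P[->|/zmin].
Qed.

Section Restriction.
Context (C : fieldType) (k : nat).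
Implicit Types (T : pred 'X_{1..k}) (p q g : {mpoly C[k]}).

Definition mrestr T p : {mpoly C[k]} :=
  \sum_(e <- msupp p | T e) p@_e *: 'X_[e].

Lemma mcoeff_mrestr T p e : (mrestr T p)@_e = if T e then p@_e else 0.
Proof.
rewrite /mrestr raddf_sum /= big_mkcond /=.
have [pe|pe] := boolP (e \in msupp p); last first.
  rewrite (memN_msupp_eq0 pe) if_same big_seq big1 // => e' pe'.
  case: ifP => // _; rewrite mcoeffZ mcoeffX.
  by case: eqP pe => [<-|_ _]; rewrite ?pe' // mulr0.
rewrite (bigD1_seq e) ?msupp_uniq //= big1 => [|e' e'e].
  by rewrite addr0 mcoeffZ mcoeffX eqxx mulr1.
by case: ifP => // _; rewrite mcoeffZ mcoeffX (negbTE e'e) mulr0.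
Qed.

Lemma msupp_mrestr T p e : (e \in msupp (mrestr T p)) = T e && (e \in msupp p).
Proof. by rewrite !mcoeff_msupp mcoeff_mrestr; case: (T e); rewrite ?eqxx. Qed.

Lemma mrestr_is_linear T : linear (mrestr T).
Proof.
move=> c p q; apply/mpolyP => e; rewrite mcoeffD mcoeffZ !mcoeff_mrestr.
by case: ifP => _; rewrite ?mcoeffD ?mcoeffZ // mulr0 addr0.
Qed.
HB.instance Definition _ T :=
  GRing.isLinear.Build C {mpoly C[k]} {mpoly C[k]} _ (mrestr T)
    (mrestr_is_linear T).

Lemma mrestrX T e : mrestr T 'X_[e] = if T e then 'X_[e] else 0.
Proof.
apply/mpolyP => e'; rewrite mcoeff_mrestr mcoeffX.
case: (eqVneq e e') => [<-|ne]; first by case: ifP => _; rewrite ?mcoeffX ?eqxx ?mcoeff0.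
by case: ifP => _; case: ifP => _; rewrite ?mcoeff0 // mcoeffX (negbTE ne).
Qed.

Lemma eq_mrestr T1 T2 p :
  {in msupp p, T1 =1 T2} -> mrestr T1 p = mrestr T2 p.
Proof.
move=> eqT; apply/mpolyP => e; rewrite !mcoeff_mrestr.
have [pe|pe] := boolP (e \in msupp p); first by rewrite eqT.
by rewrite (memN_msupp_eq0 pe) !if_same.
Qed.

Lemma mrestr_id T p : {in msupp p, forall e, T e} -> mrestr T p = p.
Proof.
move=> Tp; apply/mpolyP => e; rewrite mcoeff_mrestr; case: ifPn => // nTe.
by rewrite memN_msupp_eq0 //; apply: contra nTe => /Tp.
Qed.

Lemma mrestr_eq0 T p : {in msupp p, forall e, ~~ T e} -> mrestr T p = 0.
Proof.
move=> Tp; apply/mpolyP => e; rewrite mcoeff_mrestr mcoeff0.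
by case: ifPn => // Te; rewrite memN_msupp_eq0 //; apply/negP => /Tp; rewrite Te.
Qed.

(** Any additive function of the exponents grades the polynomials; the three used
    below are the degree, the weight for a given [w], and the value [M *m e].
    Multiplication by a homogeneous polynomial shifts this grading. *)
Lemma mrestr_homogM (V : nmodType) (deg : 'X_{1..k} -> V) (t : pred V) c g dg :
    {morph deg : e f / (e + f)%MM >-> e + f} ->
    {in msupp g, forall e, deg e = dg} ->
  mrestr (fun e => t (deg e)) (c * g) = mrestr (fun e => t (deg e + dg)) c * g.
Proof.
move=> degD gh; rewrite [c]mpolyE mulr_suml !raddf_sum mulr_suml /=.
apply: eq_bigr => e _; rewrite -scalerAl !linearZ /= -scalerAl; congr (_ *: _).
rewrite mrestrX [g]mpolyE mulr_sumr raddf_sum [RHS]mulr_sumr !big_seq /=.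
apply: eq_bigr => f gf; rewrite -!scalerAr linearZ /= -mpolyXD mrestrX /= degD (gh f gf).
by case: ifP; rewrite ?mpolyXD // mul0r.
Qed.
End Restriction.

Section InitialIdeal.
Context (C : fieldType) (k : nat) (I : set {mpoly C[k]}) (w : 'rV[rat]_k).
Implicit Types (f g h : {mpoly C[k]}).

Lemma weightD : {morph weight w : e f / (e + f)%MM >-> e + f}.
Proof.
move=> e f; rewrite /weight -big_split /=; apply: eq_bigr => i _.
by rewrite mnmDE natrD mulrDr.
Qed.

Lemma in_formE f a :
    (exists2 e, e \in msupp f & weight w e = a) ->
    {in msupp f, forall e, a <= weight w e} ->
  in_form w f = mrestr (fun e => weight w e == a) f.
Proof.
move=> [e0 fe0 we0] fa; rewrite /in_form /mrestr big_seq_cond [RHS]big_seq_cond.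
apply: eq_bigl => e; case: (boolP (e \in msupp f)) => //= fe.
apply/allP/eqP => [min_e|-> //].
by apply: le_anti; rewrite fa // -we0 min_e.
Qed.

Lemma in_form_homog f : f != 0 ->
  exists a, [/\ in_form w f = mrestr (fun e => weight w e == a) f,
    {in msupp f, forall e, a <= weight w e}
    & {in msupp (in_form w f), forall e, weight w e = a}].
Proof.
move=> f0; have [|||e fe mine] := @seq_has_min _ (relpre (weight w) <=%R) (msupp f).
- by move=> e e'; exact: le_total.
- by move=> e e' e''; exact: le_trans.
- by rewrite msupp_eq0.
exists (weight w e).
have E : in_form w f = mrestr (fun e' => weight w e' == weight w e) f.
  by apply: in_formE mine; exists e.
by split => // e'; rewrite E msupp_mrestr => /andP[/eqP].
Qed.

Hypothesis (I0 : I 0) (ID : forall f g, I f -> I g -> I (f + g)).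
Hypothesis (IM : forall c f, I f -> I (c * f)).

(** Clearing the components of the wrong weight from the coefficients of an
    expression of [h] in the initial forms lifts [h] to the ideal, without
    introducing terms of weight below [a]. *)
Lemma in_ideal_lift h a : in_ideal w I h -> exists f,
  [/\ I f, {in msupp f, forall e, a <= weight w e}
    & mrestr (fun e => weight w e == a) f = mrestr (fun e => weight w e == a) h].
Proof.
move=> [s [sI ->]]; elim: s sI => [|[c g] s IHs] sI.
  by exists 0; split => // [e|]; rewrite ?big_nil // msupp0.
have [|f [If fa fE]] := IHs; first by move=> cg scg; apply: sI; rewrite inE scg orbT.
rewrite big_cons linearD /= -fE.
have [/= f1 If1 <-] := sI (c, g) (mem_head _ _).
suff [f2 [If2 f2a f2E]] : exists f2, [/\ I f2,
    {in msupp f2, forall e, a <= weight w e}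
  & mrestr (fun e => weight w e == a) f2
    = mrestr (fun e => weight w e == a) (c * in_form w f1)].
  exists (f2 + f); split; [exact: ID| |by rewrite linearD /= f2E].
  by move=> e /msuppD_le; rewrite mem_cat => /orP[/f2a|/fa].
have [f10|f1n0] := eqVneq f1 0.
  exists 0; split => [//|e|]; first by rewrite msupp0.
  by rewrite f10 /in_form msupp0 big_nil mulr0.
have [b [inE f1b homE]] := in_form_homog f1n0.
pose c' := mrestr (fun e => weight w e + b == a) c.
exists (c' * f1); split; first exact: IM.
  move=> _ /msuppM_le /allpairsP[[e f'] /= [ce ff ->]].
  rewrite weightD; move: ce; rewrite msupp_mrestr => /andP[/eqP <- _].
  by rewrite lerD2l f1b.
(* Both sides are [c'] times the weight [b] part of [f1], once because [in_form]
   is homogeneous and once because [c'] is. *)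
rewrite (mrestr_homogM (fun x => x == a) c weightD homE) -/c' mulrC.
have c'h : {in msupp c', forall e, weight w e = a - b}.
  by move=> e; rewrite msupp_mrestr => /andP[/eqP <- _]; rewrite addrK.
rewrite (mrestr_homogM (fun x => x == a) f1 weightD c'h) mulrC inE.
congr (_ * _); apply: eq_mrestr => e _ /=.
by apply/eqP/eqP; lra.
Qed.
End InitialIdeal.

(** * The lexicographic order and the weights refining it *)

Section LexOrder.
Context (N : nat).
Implicit Types (x y z : 'cV[int]_N) (s : seq 'cV[int]_N).

Definition lexlt x y : bool := ~~ lexle y x.

Lemma lexltP x y :
  reflect (exists2 k : 'I_N, forall i : 'I_N, (i < k)%N -> x i ord0 = y i ord0
                           & x k ord0 < y k ord0) (lexlt x y).
Proof.
rewrite /lexlt /lexle -ltNge; apply: (iffP ltxi_tuplePlt).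
  by move=> [k xy ltxy]; exists k => [i /xy|]; rewrite !tnth_mktuple in ltxy *.
by move=> [k xy ltxy]; exists k => [i /xy|]; rewrite !tnth_mktuple.
Qed.

Lemma lexle_total : total (@lexle N).
Proof. by move=> x y; exact: le_total. Qed.

Lemma lexle_trans : transitive (@lexle N).
Proof. by move=> x y z; exact: le_trans. Qed.

Lemma lexle_refl : reflexive (@lexle N).
Proof. by move=> x; exact: lexx. Qed.

Lemma lexle_anti x y : lexle x y -> lexle y x -> x = y.
Proof.
move=> xy yx; apply/matrixP => i j; rewrite ord1.
have := @le_anti _ (N.-tuplelexi int) _ _ (introT andP (conj xy yx)).
move=> /(congr1 (fun t => tnth t i)).
by rewrite !tnth_mktuple.
Qed.

Lemma lexltNge x y : lexlt x y = ~~ lexle y x. Proof. by []. Qed.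

Lemma lexltW x y : lexlt x y -> lexle x y.
Proof. by rewrite /lexlt; case/orP: (lexle_total x y) => ->. Qed.

Lemma lexle_lt_trans x y z : lexle x y -> lexlt y z -> lexlt x z.
Proof. by move=> xy; apply: contra => zx; exact: lexle_trans xy. Qed.

Lemma lexlt_neq x y : lexlt x y -> y != x.
Proof. by apply: contra => /eqP ->; exact: lexle_refl. Qed.

Lemma lexle_lt x y : lexle x y -> y != x -> lexlt x y.
Proof. by move=> xy; apply: contra => yx; rewrite (lexle_anti xy yx). Qed.

Lemma lexltD2l z x y : lexlt (z + x) (z + y) = lexlt x y.
Proof.
apply/lexltP/lexltP => -[k xy]; rewrite ?mxE ?ltrD2l => ltxy; exists k => [i /xy|].
- by rewrite !mxE => /addrI.
- by [].
- by rewrite !mxE => ->.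
- by rewrite !mxE ltrD2l.
Qed.

Lemma lexleD2l z x y : lexle (z + x) (z + y) = lexle x y.
Proof. by apply: negb_inj; exact: lexltD2l. Qed.

Lemma lexleD x x' y y' : lexle x y -> lexle x' y' -> lexle (x + x') (y + y').
Proof.
move=> xy; rewrite -(lexleD2l x) => /lexle_trans; apply.
by rewrite ![_ + y']addrC lexleD2l.
Qed.

Lemma lexltD x x' y y' : lexlt x y -> lexle x' y' -> lexlt (x + x') (y + y').
Proof.
move=> xy x'y'; apply: contra xy => yx; rewrite -(lexleD2l x') ![x' + _]addrC.
by apply: lexle_trans yx; rewrite lexleD2l.
Qed.
End LexOrder.

(** In base [Q], with digits of absolute value at most [Q - 1], the first nonzero
    digit decides the sign: the digits after it cannot compensate for it. *)
Lemma horner_leading_digit N (Q : rat) (z : 'I_N -> rat) (k : 'I_N) :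
    1 <= Q -> (forall i, `|z i| <= Q - 1) ->
    (forall i : 'I_N, (i < k)%N -> z i = 0) -> 1 <= z k ->
  1 <= \sum_(i < N) Q ^+ (N - i.+1) * z i.
Proof.
move=> Q1; elim: N => [|N IHN] in z k *; first by case: k.
move=> zQ z0 zk; rewrite big_ord_recr /= subnn expr0 mul1r.
have step : \sum_(i < N) Q ^+ (N.+1 - i.+1) * z (widen_ord (leqnSn N) i)
          = Q * \sum_(i < N) Q ^+ (N - i.+1) * z (widen_ord (leqnSn N) i).
  rewrite mulr_sumr; apply: eq_bigr => i _.
  by rewrite mulrA -exprS subSS -subSn // subSS.
rewrite step; have [kN|kN] := ltnP k N; last first.
  have -> : ord_max = k by apply: val_inj => /=; have := ltn_ord k; lia.
  rewrite big1 ?mulr0 ?add0r // => i _.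
  by rewrite z0 ?mulr0 //= (leq_trans (ltn_ord i)).
have := IHN (fun i => z (widen_ord (leqnSn N) i)) (Ordinal kN).
move=> /(_ (fun i => zQ _)) /(_ (fun i => z0 (widen_ord (leqnSn N) i))).
have -> : widen_ord (leqnSn N) (Ordinal kN) = k by exact: val_inj.
move=> /(_ zk) le1; have := zQ ord_max; rewrite ler_norml => /andP[zl _].
by have := ler_wpM2l (le_trans ler01 Q1) le1; lra.
Qed.

(** The weight is the reading in a base [Q] that is large with respect to the
    differences of coordinates.  That its coordinates are at least [1] later
    gives uniform room around the points [c *m M] of the prime cone. *)
Lemma lex_refining_weight N (s : seq 'cV[int]_N) :
  exists2 c : 'rV[rat]_N, (forall i, 1 <= c ord0 i)
    & {in s &, forall x y, lexlt x y ->
        (c *m ratmx x) ord0 ord0 < (c *m ratmx y) ord0 ord0}.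
Proof.
pose B : rat := \sum_(x <- s) \sum_(i < N) `|x i ord0|%:~R.
have B0 : 0 <= B by rewrite !sumr_ge0 // => *; rewrite sumr_ge0 // => *; rewrite ler0z.
have xB x i : x \in s -> `|x i ord0|%:~R <= B.
  move=> sx; rewrite /B (big_rem x) //= (bigD1 i) //= -addrA lerDl.
  by rewrite addr_ge0 ?sumr_ge0 // => *; rewrite ?sumr_ge0 // => *; rewrite ler0z.
pose Q := B + B + 1; exists (\row_i Q ^+ (N - i.+1)) => [i|x y sx sy].
  by rewrite mxE exprn_ege1 // /Q; lra.
move=> /lexltP[k xy ltxy]; rewrite -subr_gt0.
apply: lt_le_trans ltr01 _; rewrite !mxE -sumrB.
under eq_bigr do rewrite !mxE -mulrBr.
apply: (@horner_leading_digit _ _ _ k).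
- by rewrite /Q; lra.
- move=> i; apply: le_trans (ler_normB _ _) _; rewrite -!intr_norm.
  by have := xB x i sx; have := xB y i sy; rewrite /Q; lra.
- by move=> i /xy ->; rewrite subrr.
- by rewrite -intrB ler1z; lia.
Qed.

(** * The presentation of the Cox ring and its gradings *)

Section Laurent.
Context (S : comNzRingType) (n : nat).
Implicit Types (a b : S) (v w : 'rV[int]_n).

Lemma lmonM a b v w : lmon a v * lmon b w = lmon (a * b) (v + w) :> laurent S n.
Proof. exact: Defs.lmulUU. Qed.

Lemma lmonX a v k : lmon a v ^+ k = lmon (a ^+ k) (v *+ k) :> laurent S n.
Proof.
elim: k => [|k IHk]; first by rewrite !expr0 mulr0n.
by rewrite !exprS mulrS IHk lmonM.
Qed.

Lemma lmonB a b v : lmon (a - b) v = lmon a v - lmon b v :> laurent S n.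
Proof. exact: monalg.monalgUB. Qed.

Lemma lmon_prod (J : finType) (a : J -> S) (v : J -> 'rV[int]_n) :
  \prod_j lmon (a j) (v j) = lmon (\prod_j a j) (\sum_j v j) :> laurent S n.
Proof.
apply: (big_rec3 (fun x y z => x = lmon y z :> laurent S n)) => [//|].
by move=> j x y z _ ->; rewrite lmonM.
Qed.

Lemma lmon_monomial (J K : finType) (a : J -> S) (v : J -> 'rV[int]_n)
    (w : K -> 'rV[int]_n) (f : J -> nat) (g : K -> nat) :
  (\prod_j (lmon (a j) (v j) : laurent S n) ^+ f j)
    * (\prod_i (lmon 1 (w i) : laurent S n) ^+ g i)
  = lmon (\prod_j a j ^+ f j) (\sum_j v j *+ f j + \sum_i w i *+ g i).
Proof.
under eq_bigr do rewrite lmonX.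
under [X in _ * X]eq_bigr do rewrite lmonX expr1n.
by rewrite !lmon_prod lmonM big1_eq mulr1.
Qed.

Lemma lcoef_sum (J : Type) (r : seq J) (f : J -> laurent S n) w :
  lcoef (\sum_(j <- r) f j) w = \sum_(j <- r) lcoef (f j) w.
Proof.
apply: (big_morph (fun g => lcoef g w)) => [g h|]; first exact: Defs.lcoefD.
exact: monalg.mcoeff0.
Qed.

Lemma lcoef_mon a v w : lcoef (lmon a v : laurent S n) w = if v == w then a else 0.
Proof.
have [<-|vw] := eqVneq v w; first exact: Defs.lcoefUU.
apply: monalg.mcoeff_outdom; apply/negP => /(finmap.fsubsetP (Defs.lsuppU a v)).
by rewrite finmap.in_fset1 eq_sym (negbTE vw).
Qed.

Lemma laurentP (f g : laurent S n) : (forall w, lcoef f w = lcoef g w) -> f = g.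
Proof. by move=> fg; apply/monalg.malgP => w; exact: fg. Qed.
End Laurent.

Section Presentation.
Context (C : fieldType) (n l m : nat) (A : 'M[C]_(l, m)) (D : 'M[int]_(n, m)).
Local Notation Sym := (SymE A).
Local Notation LSym := (laurent Sym n).
Implicit Types (p q : {mpoly C[m + n]}) (e : 'X_{1..m + n}) (w : 'rV[int]_n).

Lemma toSym_is_zmod_morphism : zmod_morphism (toSym A).
Proof. by move=> p q; rewrite /toSym raddfB. Qed.

Lemma toSym_is_monoid_morphism : monoid_morphism (toSym A).
Proof. by split=> [|p q]; rewrite /toSym ?rmorph1 ?rmorphM. Qed.

HB.instance Definition _ :=
  GRing.isZmodMorphism.Build {mpoly C[m]} Sym (toSym A) toSym_is_zmod_morphism.
HB.instance Definition _ :=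
  GRing.isMonoidMorphism.Build {mpoly C[m]} Sym (toSym A) toSym_is_monoid_morphism.

Lemma toSym_eq0 (p : {mpoly C[m]}) : toSym A p = 0 <-> lin_ideal A p.
Proof.
have -> : lin_ideal A p <-> p \in lin_idealb A by rewrite unfold_in; split=> /asboolP.
rewrite -[p in p \in _]subr0 Quotient.idealrBE; split=> [p0|/eqP].
  by apply/eqP; rewrite -/(toSym A p) p0; exact: esym (rmorph0 _).
by rewrite -/(toSym A p) => ->; exact: (rmorph0 (toSym A)).
Qed.

Lemma cst_is_zmod_morphism : zmod_morphism (cst n A).
Proof.
by move=> a b; rewrite /cst mpolyCB rmorphB lmonB.
Qed.

Lemma cst_is_monoid_morphism : monoid_morphism (cst n A).
Proof.
split=> [|a b]; first by rewrite /cst mpolyC1 rmorph1.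
by rewrite /cst lmonM addr0 mpolyCM rmorphM.
Qed.

HB.instance Definition _ :=
  GRing.isZmodMorphism.Build C LSym (cst n A) cst_is_zmod_morphism.
HB.instance Definition _ :=
  GRing.isMonoidMorphism.Build C LSym (cst n A) cst_is_monoid_morphism.

Lemma psi_is_zmod_morphism : zmod_morphism (psi A D).
Proof. by move=> p q; rewrite /psi raddfB. Qed.

Lemma psi_is_monoid_morphism : monoid_morphism (psi A D).
Proof. by rewrite /psi; split=> [|p q]; rewrite ?rmorph1 ?rmorphM. Qed.

HB.instance Definition _ :=
  GRing.isZmodMorphism.Build {mpoly C[m + n]} LSym (psi A D) psi_is_zmod_morphism.
HB.instance Definition _ :=
  GRing.isMonoidMorphism.Build {mpoly C[m + n]} LSym (psi A D) psi_is_monoid_morphism.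

(** The monomial of exponent [e] is sent to [y^(yexp e) t^(tdeg e)]. *)
Definition yexp e : 'X_{1..m} := [multinom e (lshift n j) | j < m].

Definition tdeg e : 'rV[int]_n :=
  \row_i (\sum_(j < m) D i j * (e (lshift n j))%:Z - (e (rshift m i))%:Z).

(** A lift to the polynomials in [y] of the coefficient of [t^w] in the image of
    [p]; no two monomials of [p] contribute the same monomial to it, as their
    [X]-exponents can be read off from [w]. *)
Definition ypart w p : {mpoly C[m]} :=
  \sum_(e <- msupp p | tdeg e == w) p@_e *: 'X_[yexp e].

Lemma psiX e : psi A D 'X_[e] = lmon (toSym A 'X_[yexp e]) (tdeg e).
Proof.
rewrite /psi mmapX /mmap1 big_split_ord /=.
under eq_bigr => j _ do rewrite (unsplitK (inl j)).
under [X in _ * X]eq_bigr => j _ do rewrite (unsplitK (inr j)).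
apply: etrans (lmon_monomial _ _ _ _ _) _; apply: (f_equal2 (@lmon Sym n)).
  rewrite [in RHS]mpolyXE_id rmorph_prod /=.
  by apply: eq_bigr => j _; rewrite rmorphXn /= mnmE.
apply/rowP => i; rewrite !mxE !summxE; congr (_ + _).
  by apply: eq_bigr => j _; rewrite mulmxnE !mxE -mulr_natr natz.
rewrite (bigD1 i) //= mulmxnE !mxE eqxx mulNrn natz big1 ?addr0 // => j ji.
by rewrite mulmxnE !mxE [i == j]eq_sym (negbTE ji) andbF oppr0 mul0rn.
Qed.

Lemma psi_sum p :
  psi A D p = \sum_(e <- msupp p) lmon (toSym A (p@_e *: 'X_[yexp e])) (tdeg e).
Proof.
rewrite {1}[p]mpolyE rmorph_sum /=; apply: eq_bigr => e _.
rewrite -mul_mpolyC rmorphM /= psiX [psi _ _ _%:MP]mmapC /cst lmonM add0r.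
by rewrite -rmorphM mul_mpolyC.
Qed.

Lemma lcoef_psi p w : lcoef (psi A D p) w = toSym A (ypart w p).
Proof.
rewrite psi_sum lcoef_sum /ypart raddf_sum /= [RHS]big_mkcond /=.
by apply: eq_bigr => e _; rewrite lcoef_mon.
Qed.

Lemma ypart_mrestr (t : 'rV[int]_n -> pred nat) p w :
  ypart w (mrestr (fun e => t (tdeg e) (mdeg (yexp e))) p)
    = mrestr (fun y => t w (mdeg y)) (ypart w p).
Proof.
pose Y p := \sum_(e <- msupp p) (if tdeg e == w then p@_e *: 'X_[yexp e] else 0).
have YE q (s : seq 'X_{1..m + n}) : uniq s -> {subset msupp q <= s} ->
    ypart w q = \sum_(e <- s | tdeg e == w) q@_e *: 'X_[yexp e].
  move=> us qs; rewrite /ypart [RHS]big_mkcond [LHS]big_mkcond /=.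
  rewrite [RHS](bigID (mem (msupp q))) /= [X in _ + X]big1 ?addr0; last first.
    by move=> e /memN_msupp_eq0 ->; rewrite scale0r if_same.
  rewrite -[RHS]big_filter; apply: perm_big; apply: uniq_perm.
  - exact: msupp_uniq.
  - exact: filter_uniq.
  - by move=> e; rewrite mem_filter; apply/idP/andP => [qe|[]//]; rewrite qs.
rewrite (YE _ (msupp p)) ?msupp_uniq //; last first.
  by move=> e; rewrite msupp_mrestr => /andP[].
rewrite raddf_sum /=; apply: eq_bigr => e /eqP ew.
rewrite mcoeff_mrestr linearZ /= mrestrX ew.
by case: ifP => _; rewrite ?scale0r ?scaler0.
Qed.

Lemma mdeg_linform (c : 'rV[C]_m) : {in msupp (linform c), forall y, mdeg y = 1%N}.
Proof.
move=> y; rewrite /linform mcoeff_msupp raddf_sum /= => ne0.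
have [j] : exists j, mcoeff y (c ord0 j *: 'X_j) != 0.
  apply/existsP; apply: contraNT ne0; rewrite negb_exists => /forallP e0.
  by rewrite big1 // => j _; apply/eqP; move: (e0 j); rewrite negbK.
rewrite mcoeffZ mcoeffX; have [<- _|_] := eqVneq U_(j)%MM y; first by rewrite mdeg1.
by rewrite mulr0 eqxx.
Qed.

(** [L] is generated by homogeneous elements, hence it is a homogeneous ideal. *)
Lemma lin_ideal_homog (t : pred nat) (p : {mpoly C[m]}) :
  lin_ideal A p -> lin_ideal A (mrestr (fun y => t (mdeg y)) p).
Proof.
move=> [s [sL ->]]; rewrite raddf_sum /= big_seq.
elim/big_rec: _ => [|[c g] x cgs xL]; first exact: ideal_gen0.
apply: ideal_genD => //; have [/= i _ gE] := sL _ cgs.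
have gh : {in msupp g, forall y, mdeg y = 1%N} by rewrite -gE; exact: mdeg_linform.
rewrite (mrestr_homogM t c (@mdegD m) gh); apply: ideal_genM.
exists [:: (1, g)]; split=> [cg|]; rewrite ?big_seq1 ?mul1r //.
by rewrite inE => /eqP ->; exists i.
Qed.

(** The coefficient of a relation at each [t^w] lies in the homogeneous ideal [L],
    so the relations are homogeneous for the torus weight and the degree in the
    [y]-variables together. *)
Lemma psi_mrestr_eq0 (t : 'rV[int]_n -> pred nat) p :
  psi A D p = 0 -> psi A D (mrestr (fun e => t (tdeg e) (mdeg (yexp e))) p) = 0.
Proof.
move=> p0; apply: laurentP => w.
rewrite lcoef_psi ypart_mrestr; have -> : lcoef (0 : LSym) w = 0 by exact: monalg.mcoeff0.
apply/toSym_eq0/lin_ideal_homog/toSym_eq0; rewrite -lcoef_psi p0.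
exact: monalg.mcoeff0.
Qed.
End Presentation.

(** * Adapted representatives compute the valuation *)

Lemma count_lt (T : eqType) (a b : pred T) (s : seq T) x :
  subpred a b -> x \in s -> b x -> ~~ a x -> (count a s < count b s)%N.
Proof.
move=> ab sx bx nax; elim: s sx => // y s IHs.
have le_ab : (count a s <= count b s)%N by exact: sub_count.
rewrite inE => /predU1P[<-|/IHs lt_ab] /=; first by rewrite bx (negbTE nax).
by apply: leq_ltn_trans (leq_add (_ : (a y <= b y)%N) (leqnn _)) _;
  [case: (a y) (ab y) => // -> | rewrite ltn_add2l].
Qed.

Section FineDegree.
Context (C : fieldType) (n m : nat) (D : 'M[int]_(n, m)).
Implicit Types (e : 'X_{1..m + n}) (p : {mpoly C[m + n]}).

(** The torus weight and the [y]-degree of a monomial bound its degree: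
    the former determines the exponents of the [X_i] from those of the [Y_j]. *)
Lemma mdeg_le_fine e :
  (mdeg e <= mdeg (yexp e)
     + \sum_(i < n) (\sum_(j < m) `|D i j| * mdeg (yexp e) + `|tdeg D e ord0 i|))%N.
Proof.
have -> : mdeg e = (mdeg (yexp e) + \sum_(i < n) e (rshift m i))%N.
  rewrite !mdegE big_split_ord /=; congr (_ + _)%N.
  by apply: eq_bigr => j _; rewrite mnmE.
rewrite leq_add2l; apply: leq_sum => i _.
rewrite -lez_nat PoszD.
have -> : (e (rshift m i))%:Z
    = \sum_(j < m) D i j * (e (lshift n j))%:Z - tdeg D e ord0 i.
  by rewrite mxE opprB addrC subrK.
apply: lerD; last by rewrite abszE -normrN ler_norm.
rewrite (big_morph Posz PoszD (erefl _)); apply: ler_sum => j _.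
have ej : (e (lshift n j) <= mdeg (yexp e))%N.
  by rewrite mdegE (bigD1 j) //= mnmE leq_addr.
apply: le_trans (ler_norm _) _; rewrite normrM PoszM abszE.
by rewrite ler_wpM2l.
Qed.

(** The monomials within which a representative of the class of [p] can be
    sought: those sharing both degrees with some monomial of [p]. *)
Definition same_degree p e : bool :=
  has (fun f => (tdeg D f == tdeg D e) && (mdeg (yexp f) == mdeg (yexp e))) (msupp p).

Lemma same_degree_finite p :
  exists s : seq 'X_{1..m + n}, forall e, same_degree p e -> e \in s.
Proof.
pose b f := (mdeg (yexp f) + \sum_(i < n)
  (\sum_(j < m) `|D i j| * mdeg (yexp f) + `|tdeg D f ord0 i|))%N.
pose B := (\sum_(f <- msupp p) b f).+1.
exists (map val (enum {: bmultinom (m + n) B})) => e /hasP[f pf /andP[/eqP fe1 /eqP fe2]].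
have eB : (mdeg e < B)%N.
  rewrite ltnS (leq_trans (mdeg_le_fine e)) // -fe1 -fe2 -/(b f).
  by rewrite (big_rem f) //= leq_addr.
by apply/mapP; exists (BMultinom eB); rewrite ?mem_enum.
Qed.
End FineDegree.

Section LexDegeneration.
(* Values and weights are compared by their order properties, never computed. *)
Local Opaque lexle weight.

Context (C : fieldType) (n l m N : nat).
Context (A : 'M[C]_(l, m)) (D : 'M[int]_(n, m)) (M : 'M[int]_(N, m + n)).
Implicit Types (p q : {mpoly C[m + n]}) (e f : 'X_{1..m + n}) (x y : 'cV[int]_N).

Definition mval e : 'cV[int]_N := M *m expv e.

Lemma mvalD : {morph mval : e f / (e + f)%MM >-> e + f}.
Proof.
move=> e f; rewrite /mval -mulmxDr; congr (_ *m _).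
by apply/colP => k; rewrite !mxE mnmDE PoszD.
Qed.

Definition lex_part x p := mrestr (fun e => mval e == x) p.

(** A single ideal [J] serves as the initial ideal of the relations for the
    lexicographic order of the values: finitely many monomials at a time, this
    order is the one given by some weight [w] with initial ideal [J]. *)
Definition lex_degeneration (J : set {mpoly C[m + n]}) : Prop :=
  forall s : seq 'X_{1..m + n}, exists w,
    [/\ in_ideal w (cox_ideal A D) = J,
        forall e f, mval e = mval f -> weight w e = weight w f
      & {in s &, forall e f, lexlt (mval e) (mval f) -> weight w e < weight w f}].

Lemma cox_ideal0 : cox_ideal A D 0.
Proof. exact: rmorph0. Qed.

Lemma cox_idealD p q :
  cox_ideal A D p -> cox_ideal A D q -> cox_ideal A D (p + q).
Proof. by rewrite /cox_ideal /= rmorphD /= => -> ->; rewrite addr0. Qed.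

Lemma cox_idealM p q : cox_ideal A D q -> cox_ideal A D (p * q).
Proof. by rewrite /cox_ideal /= rmorphM /= => ->; rewrite mulr0. Qed.

Lemma min_value_exists p : p != 0 -> exists x, is_min_value M p x.
Proof.
move=> p0; have [|||e pe mine] := @seq_has_min _ (relpre mval (@lexle N)) (msupp p).
- by move=> e f; exact: lexle_total.
- by move=> e f g; exact: lexle_trans.
- by rewrite msupp_eq0.
by exists (mval e); split; first exists e.
Qed.

Lemma is_val_unique (g : laurent (SymE A) n) x y :
  is_val A D M g x -> is_val A D M g y -> x = y.
Proof.
move=> [[p pf px] xmax] [[q qf qy] ymax].
by apply: lexle_anti; [exact: ymax px | exact: xmax qy].
Qed.

Lemma val_M_unique (g : laurent (SymE A) n) x :
  is_val A D M g x -> val_M A D M g = x.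
Proof.
move=> gx; have := @xgetPex _ 0 (is_val A D M g) (ex_intro _ x gx).
by move=> /is_val_unique /(_ gx).
Qed.

Context (J : set {mpoly C[m + n]}).
Hypothesis (degJ : lex_degeneration J) (primeJ : prime_ideal J).

(** No value of [p] is below [x], and the part of [p] of value [x] survives in the
    quotient by [J]; in particular it is nonzero. *)
Definition adapted p x : Prop :=
  {in msupp p, forall e, lexle x (mval e)} /\ ~ J (lex_part x p).

Lemma degeneration0 : J 0.
Proof. by have [w [<- _ _]] := degJ [::]; exact: ideal_gen0. Qed.

Lemma degenerationM p q : J q -> J (p * q).
Proof. by have [w [<- _ _]] := degJ [::]; exact: ideal_genM. Qed.

Lemma adapted_min p x : adapted p x -> is_min_value M p x.
Proof.
move=> [px nJ]; split=> //; apply: contrapT => nex; apply: nJ.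
rewrite /lex_part mrestr_eq0; first exact: degeneration0.
by move=> e pe; apply/eqP => ex; apply: nex; exists e.
Qed.

(** The defining property of [J]: for a weight that refines the lexicographic
    order on the monomials of the relation [g], the initial form of [g] is its
    part of least value. *)
Lemma relation_lex_part g x :
    psi A D g = 0 -> {in msupp g, forall e, lexle x (mval e)} -> J (lex_part x g).
Proof.
move=> g0 gx; have [[e0 ge0 e0x]|nex] :=
  pselect (exists2 e, e \in msupp g & mval e = x); last first.
  rewrite /lex_part mrestr_eq0; first exact: degeneration0.
  by move=> e ge; apply/eqP => ex; apply: nex; exists e.
have [w [inw eqw ltw]] := degJ (msupp g).
have ltE e : e \in msupp g -> mval e != x -> weight w e0 < weight w e.
  move=> ge nex; apply: ltw; [exact: ge0 | exact: ge |].
  by rewrite e0x; apply: lexle_lt nex; exact: gx.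
have eqE e : mval e = x -> weight w e = weight w e0.
  by move=> ex; apply: eqw; rewrite ex.
have inwE : in_form w g = lex_part x g.
  rewrite (in_formE (a := weight w e0)).
  - apply/mpolyP => e; rewrite !mcoeff_mrestr.
    have [ex|nex] := eqVneq (mval e) x; first by rewrite (eqE e ex) eqxx.
    have [ge|ge] := boolP (e \in msupp g); first by rewrite (gt_eqF (ltE e ge nex)).
    by rewrite (memN_msupp_eq0 ge) if_same.
  - by exists e0; [exact: ge0 | exact: erefl].
  - move=> e ge; have [ex|nex] := eqVneq (mval e) x; first by rewrite (eqE e ex).
    by apply: ltW; exact: ltE.
rewrite -inwE -inw; exists [:: (1, in_form w g)].
split; last by rewrite big_seq1 mul1r.
by move=> cg; rewrite inE => /eqP -> /=; exists g; [exact: g0 | exact: erefl].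
Qed.

Lemma adapted_neq0 p x : adapted p x -> psi A D p != 0.
Proof.
move=> [px nJ]; apply: contra_notN nJ => /eqP p0.
exact: relation_lex_part p0 px.
Qed.

(** A representative with a larger minimum would exhibit the lowest part of [p]
    as the lowest part of a relation. *)
Lemma adapted_is_val p x : adapted p x -> is_val A D M (psi A D p) x.
Proof.
move=> pa; have [[e0 pe0 e0x] px] := adapted_min pa; have [_ nJ] := pa.
split; first by exists p => //; split=> //; exists e0.
move=> q y qp [_ qy]; apply: contrapT => /negP ltxy; apply: nJ.
have qx e : e \in msupp q -> lexlt x (mval e).
  by move=> /qy; apply: contraL => ex; apply: contra ltxy => /lexle_trans; apply.
have -> : lex_part x p = lex_part x (p - q).
  rewrite /lex_part raddfB /=; have -> : mrestr (fun e => mval e == x) q = 0.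
    by apply: mrestr_eq0 => e /qx /lexlt_neq.
  exact: esym (subr0 _).
apply: relation_lex_part; first by rewrite rmorphB /= qp subrr.
by move=> e /msuppB_le; rewrite mem_cat => /orP[/px|/qx /lexltW].
Qed.

(** Subtracting a relation that lifts the lowest part of [p], truncated to the
    degrees of [p], raises the minimum. *)
Lemma subduction_step p p0 x :
    {in msupp p, forall e, same_degree D p0 e} -> is_min_value M p x ->
    J (lex_part x p) ->
  exists q, [/\ psi A D q = psi A D p, {in msupp q, forall e, same_degree D p0 e}
    & {in msupp q, forall e, lexlt x (mval e)}].
Proof.
move=> pT [[e0 pe0 e0x] px] Jp; have [s sT] := same_degree_finite D p0.
have [w [inw eqw ltw]] := degJ s; rewrite -inw in Jp.
have [g [Ig ga gE]] :=
  in_ideal_lift cox_ideal0 cox_idealD cox_idealM (weight w e0) Jp.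
pose h := mrestr (same_degree D p0) g.
have h0 : psi A D h = 0.
  pose t v d := has (fun f => (tdeg D f == v) && (mdeg (yexp f) == d)) (msupp p0).
  exact: (psi_mrestr_eq0 t).
have qT e : e \in msupp (p - h) -> same_degree D p0 e.
  by move=> /msuppB_le; rewrite mem_cat msupp_mrestr => /orP[/pT|/andP[]].
exists (p - h); split; [by rewrite rmorphB /= h0 subr0 | exact: qT | move=> e qe].
move: (qe); rewrite mcoeff_msupp mcoeffB mcoeff_mrestr (qT e qe).
have [ex|nex] := eqVneq (mval e) x.
  have we : weight w e = weight w e0 by apply: eqw; rewrite ex.
  have := congr1 (mcoeff e) gE; rewrite !mcoeff_mrestr we ex !eqxx => ->.
  by rewrite subrr eqxx.
apply: contraR => /negPn le_ex.
have lt_ex : lexlt (mval e) (mval e0).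
  by rewrite {2}/mval -e0x; apply: lexle_lt le_ex _; rewrite eq_sym.
have -> : p@_e = 0.
  apply: memN_msupp_eq0; apply/negP => /px; rewrite e0x => le_e0e.
  by move: lt_ex; rewrite lexltNge le_e0e.
have -> : g@_e = 0.
  apply: memN_msupp_eq0; apply/negP => /ga.
  by rewrite leNgt (ltw e e0 (sT e (qT e qe)) (sT e0 (pT e0 pe0)) lt_ex).
by rewrite subrr.
Qed.

(** Each step of subduction strictly raises the minimum, which takes its values
    in a finite set. *)
Lemma adapted_exists p : psi A D p != 0 ->
  exists q x, psi A D q = psi A D p /\ adapted q x.
Proof.
move=> pn0; have [s sT] := same_degree_finite D p.
suff H k : forall q x, psi A D q = psi A D p ->
    {in msupp q, forall e, same_degree D p e} -> is_min_value M q x ->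
    (count (fun e => lexlt x (mval e)) s < k)%N ->
  exists q x, psi A D q = psi A D p /\ adapted q x.
  have [|x px] := @min_value_exists p.
    by apply: contraNneq pn0 => ->; rewrite rmorph0.
  apply: (H _ p x erefl _ px (leqnn _)) => e pe; apply/hasP; exists e => //.
  by rewrite !eqxx.
elim: k => [|k IHk] q x qp qT qx cnt; first by rewrite ltn0 in cnt.
have [Jq|nJq] := pselect (J (lex_part x q)); last first.
  by exists q, x; split; [exact: qp | split; [exact: qx.2 | exact: nJq]].
have [q' [q'p q'T q'x]] := subduction_step qT qx Jq.
have [|y q'y] := @min_value_exists q'.
  by apply: contraNneq pn0 => q'0; rewrite -qp -q'p q'0 rmorph0.
have [[e q'e ey] _] := q'y.
apply: (IHk q' y _ q'T q'y); first by rewrite q'p.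
rewrite ltnS in cnt; apply: leq_trans cnt; apply: (@count_lt _ _ _ _ e).
- by move=> f; apply: lexle_lt_trans; apply: lexltW; rewrite ey; exact: q'x.
- exact/sT/q'T.
- exact: q'x.
- by rewrite ey; apply/negPn; exact: lexle_refl.
Qed.

(** The lowest part of a product is the product of the lowest parts, and [J] is
    prime. *)
Lemma adaptedM p q x y : adapted p x -> adapted q y -> adapted (p * q) (x + y).
Proof.
move=> [px nJp] [qy nJq]; split.
  move=> _ /msuppM_le /allpairsP[[e f] /= [pe qf ->]].
  by rewrite mvalD lexleD ?px ?qy.
have hx : {in msupp (lex_part x p), forall e, mval e = x}.
  by move=> e; rewrite msupp_mrestr => /andP[/eqP].
suff -> : lex_part (x + y) (p * q) = lex_part y q * lex_part x p.
  by move=> /primeJ.2 [].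
have -> : p * q = q * lex_part x p + (p - lex_part x p) * q.
  by rewrite mulrBl [q * _]mulrC addrC subrK.
rewrite [lex_part _ _]raddfD /= [X in _ + X]mrestr_eq0 ?addr0.
  rewrite /lex_part (mrestr_homogM (fun z => z == x + y) q mvalD hx).
  by congr (_ * _); apply: eq_mrestr => e _ /=; rewrite [x + y]addrC (inj_eq (addIr x)).
move=> _ /msuppM_le /allpairsP[[e f] /= [pe qf ->]]; rewrite mvalD.
apply: lexlt_neq; apply: lexltD; last exact: qy.
move: pe; rewrite mcoeff_msupp mcoeffB mcoeff_mrestr.
have [ex|nex] := eqVneq (mval e) x; first by rewrite subrr eqxx.
by rewrite subr0 -mcoeff_msupp => /px /lexle_lt; exact.
Qed.

Lemma val_M_adapted (g : laurent (SymE A) n) :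
    g != 0 -> (exists p, psi A D p = g) ->
  exists2 p, psi A D p = g & adapted p (val_M A D M g).
Proof.
move=> g0 [p pg]; rewrite -pg in g0 *.
have [q [x [qp qx]]] := adapted_exists g0.
have vx := adapted_is_val qx; rewrite qp in vx.
exists q; first exact: qp.
by rewrite (val_M_unique vx).
Qed.

Lemma val_M_eq p x : adapted p x -> val_M A D M (psi A D p) = x.
Proof.
by move=> px; exact: val_M_unique (adapted_is_val px).
Qed.
End LexDegeneration.

(** * Images of rational polyhedra are closed *)

Section Polyhedra.
Implicit Types (p q k : nat).

Definition nonneg q : set 'cV[rat]_q := [set z | forall i, 0 <= z i ord0].

(** The general form of a linear image of a rational polyhedron. *)
Definition polyhedron p q k (B : 'M[rat]_(p, q)) (E : 'M[rat]_(k, q))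
    (h : 'cV[rat]_k) : set 'cV[rat]_p :=
  [set B *m z | z in [set z | nonneg z /\ E *m z = h]].

Local Notation pairing g x := ((g *m x) ord0 ord0).

(** One step of Fourier-Motzkin elimination: the bounds that the constraints
    put on [t] are compatible as soon as they are so two by two. *)
Lemma fourier_motzkin p (s : seq 'rV[rat]_p) (b : 'cV[rat]_p) :
  exists s' : seq 'rV[rat]_p, forall x : 'cV[rat]_p,
    (exists2 t, 0 <= t & {in s, forall g, 0 <= pairing g (x - t *: b)})
    <-> {in s', forall g, 0 <= pairing g x}.
Proof.
pose u (g : 'rV[rat]_p) := pairing g b.
have uE g (x : 'cV[rat]_p) t : pairing g (x - t *: b) = pairing g x - t * u g.
  by rewrite mulmxBr -scalemxAr /u !mxE.
pose comb gg : 'rV[rat]_p := u gg.1 *: gg.2 - u gg.2 *: gg.1.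
have combE gg (x : 'cV[rat]_p) :
    pairing (comb gg) x = u gg.1 * pairing gg.2 x - u gg.2 * pairing gg.1 x.
  by rewrite /comb mulmxBl -!scalemxAl /u !mxE.
pose pos := [seq g <- s | 0 < u g]; pose neg := [seq g <- s | u g < 0].
exists ([seq g <- s | 0 <= u g]
  ++ [seq comb gg | gg <- [seq (g, g') | g <- pos, g' <- neg]]).
move=> x; split.
  move=> [t t0 st] g; rewrite mem_cat => /orP[].
    rewrite mem_filter => /andP[ug /st]; rewrite uE subr_ge0; apply: le_trans.
    exact: mulr_ge0.
  move=> /mapP[_ /allpairsP[[g1 g2] /= [+ + ->]] ->].
  rewrite !mem_filter combE /= => /andP[u1 /st s1] /andP[u2 /st s2].
  rewrite !uE in s1 s2.
  have := mulr_ge0 (ltW u1) s2; have := mulr_ge0 (_ : 0 <= - u g2) s1.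
  by rewrite oppr_ge0 => /(_ (ltW u2)); nra.
move=> sx; pose lows := 0 :: [seq pairing g x / u g | g <- neg].
have [|||t lt tmax] := @seq_has_min _ (fun a b : rat => b <= a) lows.
- by move=> a c; exact: le_total.
- by move=> a c d ca ad; exact: le_trans ad ca.
- by [].
have t0 : 0 <= t by apply: tmax; rewrite mem_head.
exists t => // g sg; rewrite uE subr_ge0.
have [ug|ug|ug] := ltgtP (u g) 0.
- rewrite -ler_ndivrMr //; apply: tmax; rewrite inE; apply/orP; right.
  by apply/mapP; exists g; rewrite // mem_filter ug.
- rewrite -ler_pdivlMr //.
  have gx : 0 <= pairing g x.
    by apply: sx; rewrite mem_cat mem_filter (ltW ug) sg.
  move: lt; rewrite inE => /predU1P[->|/mapP[g' g'neg ->]].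
    by rewrite divr_ge0 // ltW.
  have ug' : u g' < 0 by move: g'neg; rewrite mem_filter => /andP[].
  rewrite ler_ndivrMr // mulrAC ler_pdivrMr //.
  have : 0 <= pairing (comb (g, g')) x.
    apply: sx; rewrite mem_cat; apply/orP; right; apply/mapP; exists (g, g') => //.
    by apply/allpairsP; exists (g, g'); rewrite mem_filter ug sg.
  by rewrite combE /= subr_ge0 ![_ * u _]mulrC.
- rewrite ug mulr0; apply: sx; rewrite mem_cat mem_filter ug lexx sg //.
Qed.

(** Weyl's half of the Minkowski-Weyl theorem: the generators are added one at a
    time, the coefficient of the new one being eliminated. *)
Lemma weyl p q (B : 'M[rat]_(p, q)) : exists s : seq 'rV[rat]_p,
  forall x, (exists2 z, nonneg z & x = B *m z)
            <-> {in s, forall g, 0 <= pairing g x}.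
Proof.
elim: q B => [|q IHq] B.
  exists ([seq delta_mx 0 i | i : 'I_p] ++ [seq - delta_mx 0 i | i : 'I_p]) => x.
  have dE i : pairing (delta_mx 0 i : 'rV_p) x = x i ord0 by rewrite -rowE mxE.
  split=> [[z _ ->] g _|sx]; first by rewrite thinmx0 mul0mx mulmx0 mxE.
  exists 0; first by move=> i; rewrite mxE.
  rewrite mulmx0; apply/colP => i; rewrite mxE; apply: le_anti.
  apply/andP; split.
    rewrite -oppr_ge0 -dE.
    have -> : - pairing (delta_mx 0 i : 'rV_p) x = pairing (- delta_mx 0 i : 'rV_p) x.
      by rewrite mulNmx [RHS]mxE.
    apply: sx; rewrite mem_cat; apply/orP; right; apply/mapP; exists i => //.
    by rewrite ?mem_enum.
  rewrite -dE; apply: sx; rewrite mem_cat; apply/orP; left; apply/mapP.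
  by exists i; rewrite ?mem_enum.
rewrite -[q.+1]/(1 + q)%N in B *.
have [s sP] := IHq (rsubmx B).
have [s' s'P] := fourier_motzkin s (lsubmx B); exists s' => x.
rewrite -s'P; split=> [[z z0 ->]|[t t0 /sP[z z0 xE]]].
  exists (z (lshift q ord0) ord0) => //; apply/sP; exists (dsubmx z).
    by move=> i; rewrite mxE.
  rewrite -[B in B *m z]hsubmxK -[z in _ *m z]vsubmxK mul_row_col addrAC.
  have -> : usubmx z = (z (lshift q ord0) ord0)%:M.
    by apply/matrixP => i j; rewrite !ord1 !mxE mulr1n.
  by rewrite mul_mx_scalar subrr add0r.
exists (col_mx t%:M z).
  by move=> i; rewrite mxE; case: splitP => j _; rewrite ?ord1 ?mxE.
by rewrite -[B in RHS]hsubmxK mul_row_col mul_mx_scalar -xE addrC subrK.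
Qed.

(** A point violating one of the finitely many inequalities has a neighbourhood
    of points that violate it. *)
Lemma Qclosure_cone p q (B : 'M[rat]_(p, q)) (x : 'cV[rat]_p) :
  Qclosure [set B *m z | z in @nonneg q] x -> exists2 z, nonneg z & x = B *m z.
Proof.
move=> clx; have [s sP] := weyl B; apply/sP => g sg; rewrite leNgt; apply/negP => gx.
pose G := 1 + \sum_i `|g ord0 i|.
have G0 : 0 < G by rewrite ltr_wpDr // sumr_ge0.
have gx0 : 0 < - pairing g x by rewrite oppr_gt0.
have [_ [z z0 <-] zx] := clx (- pairing g x / G) (divr_gt0 gx0 G0).
have : 0 <= pairing g (B *m z) by have [+ _] := sP (B *m z); apply; first exists z.
apply/negP; rewrite -ltNge -[B *m z](subrK x) mulmxDr mxE -ltrBrDr sub0r.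
apply: le_lt_trans (ler_norm _) _; rewrite mxE.
apply: le_lt_trans (ler_norm_sum _ _ _) _.
apply: (@le_lt_trans _ _ (\sum_i `|g ord0 i| * (- pairing g x / G))).
  apply: ler_sum => i _; rewrite normrM ler_wpM2l //.
  by apply: ltW; have := zx i ord0; rewrite !mxE.
rewrite -mulr_suml mulrCA gtr_pMr ?oppr_gt0 //.
by rewrite ltr_pdivrMr // mul1r /G ltrDr.
Qed.

(** The polyhedron is a slice of the cone generated by the columns of
    [col_mx B E], namely the one at height [h]. *)
Lemma Qclosure_polyhedron p q k (B : 'M[rat]_(p, q)) (E : 'M[rat]_(k, q)) h :
  Qclosure (polyhedron B E h) `<=` polyhedron B E h.
Proof.
move=> x clx; have [|z z0] := @Qclosure_cone _ _ (col_mx B E) (col_mx x h).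
  move=> e e0; have [_ [z [z0 Ez] <-] zx] := clx e e0.
  exists (col_mx B E *m z); first by exists z.
  move=> i j; rewrite mul_col_mx Ez !mxE; case: splitP => i' _; first exact: zx.
  by rewrite subrr normr0.
by rewrite mul_col_mx => /eq_col_mx[-> ->]; exists z.
Qed.

(** This gives convexity and, for [h = 0], stability under nonnegative
    combinations. *)
Lemma polyhedron_comb p q k (B : 'M[rat]_(p, q)) (E : 'M[rat]_(k, q)) h
    (s : seq (rat * 'cV[rat]_p)) :
  (forall cv, cv \in s -> 0 <= cv.1 /\ polyhedron B E h cv.2) ->
  polyhedron B E ((\sum_(cv <- s) cv.1) *: h) (\sum_(cv <- s) cv.1 *: cv.2).
Proof.
elim: s => [|[c v] s IHs] sP.
  exists 0; last by rewrite mulmx0 big_nil.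
  by split=> [i|]; rewrite ?mxE // mulmx0 big_nil scale0r.
have [|z [z0 Ez] Bz] := IHs; first by move=> cv scv; apply: sP; rewrite inE scv orbT.
have [/= c0 [y [y0 Ey] By]] := sP (c, v) (mem_head _ _).
exists (c *: y + z).
  split=> [i|]; first by rewrite !mxE addr_ge0 // mulr_ge0.
  by rewrite mulmxDr -scalemxAr Ey Ez big_cons scalerDl.
by rewrite mulmxDr -scalemxAr By Bz big_cons.
Qed.

Lemma conv_hull_polyhedron p q k (B : 'M[rat]_(p, q)) (E : 'M[rat]_(k, q)) h :
  conv_hull (polyhedron B E h) `<=` polyhedron B E h.
Proof. by move=> _ [s [sP s1 ->]]; have := polyhedron_comb sP; rewrite s1 scale1r. Qed.

Lemma cone_hull_polyhedron p q k (B : 'M[rat]_(p, q)) (E : 'M[rat]_(k, q)) :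
  cone_hull (polyhedron B E 0) `<=` polyhedron B E 0.
Proof. by move=> _ [s [sP ->]]; have := polyhedron_comb sP; rewrite scaler0. Qed.
End Polyhedra.

Section Hulls.
Context (p q : nat).
Implicit Types X Y : set 'M[rat]_(p, q).

Lemma sub_Qclosure X : X `<=` Qclosure X.
Proof. by move=> x Xx e e0; exists x => // i j; rewrite subrr normr0. Qed.

Lemma QclosureS X Y : X `<=` Y -> Qclosure X `<=` Qclosure Y.
Proof. by move=> XY x clx e /clx[y /XY ? ?]; exists y. Qed.

Lemma sub_conv_hull X : X `<=` conv_hull X.
Proof.
move=> x Xx; exists [:: (1, x)]; rewrite !big_seq1 scale1r; split=> // cv.
by rewrite inE => /eqP ->.
Qed.

Lemma conv_hullS X Y : X `<=` Y -> conv_hull X `<=` conv_hull Y.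
Proof. by move=> XY _ [s [sX s1 ->]]; exists s; split=> // cv /sX[? /XY]. Qed.

Lemma cone_hullS X Y : X `<=` Y -> cone_hull X `<=` cone_hull Y.
Proof. by move=> XY _ [s [sX ->]]; exists s; split=> // cv /sX[? /XY]. Qed.
End Hulls.

(** * The matrix M and the prime cone *)

Section FlagMatrix.
Context (n m r : nat) (D : 'M[int]_(n, m)) (F : 'I_r -> {set 'I_m}).
Local Notation M := (bigM D F).

Hypothesis (F0 : forall i, F i != finset.set0).
Hypothesis (Flt : forall i j : 'I_r, (i < j)%N -> F i \proper F j).

Lemma flag_sub (i j : 'I_r) : (i <= j)%N -> F i \subset F j.
Proof. by rewrite leq_eqVlt => /predU1P[/val_inj ->|/Flt/proper_sub]. Qed.

(** On the columns of such a transversal [EK] is unitriangular. *)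
Lemma flag_transversal :
  exists t : 'I_r -> 'I_m, forall i k : 'I_r, (t k \in F i) = (k <= i)%N.
Proof.
suff H (k : 'I_r) : exists j, forall i : 'I_r, (j \in F i) = (k <= i)%N.
  by exists (fun k => projT1 (cid (H k))) => i k; exact: (projT2 (cid (H k)) i).
have [k0|k0] := posnP k.
  have /set0Pn[j jF] := F0 k; exists j => i.
  by rewrite k0 leq0n; apply: (fintype.subsetP (@flag_sub k i _)) jF; rewrite k0.
have pk : (k.-1 < r)%N by rewrite (leq_ltn_trans (leq_pred _)).
have /Flt/properP[_ [j jF jF']] : (Ordinal pk < k)%N by rewrite /= prednK.
exists j => i; have [ki|ik] := leqP k i; first exact: (fintype.subsetP (flag_sub ki)).
apply/negbTE; apply: contra jF'; apply/fintype.subsetP/flag_sub.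
by rewrite /= -ltnS prednK.
Qed.

(** The variables [X_i] give the block [- 1], the [Y_j] of a transversal of the
    flag a unitriangular one. *)
Lemma bigM_minor :
  exists sel : 'I_(n + r) -> 'I_(m + n), \det (colsub sel M) != 0.
Proof.
have [t tF] := flag_transversal.
pose sel (k : 'I_(n + r)) := match fintype.split k with
  | inl i => rshift m i | inr i => lshift n (t i) end.
exists sel; have -> : colsub sel M
    = block_mx (- 1%:M) (colsub t D) 0 (\matrix_(i, k) (k <= i)%N%:R).
  apply/matrixP => i k; rewrite mxE /sel /bigM.
  case: (split_ordP k) => k' ->;
    rewrite ?(unsplitK (inl k')) ?(unsplitK (inr k'));
    case: (split_ordP i) => i' ->;
    by rewrite ?block_mxEul ?block_mxEur ?block_mxEdl ?block_mxEdr !mxE ?tF.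
rewrite det_ublock mulf_neq0 //.
  by rewrite -scaleN1r detZ det1 mulr1 expf_neq0.
rewrite det_trig.
  by rewrite big1 ?oner_neq0 // => i _; rewrite mxE leqnn.
by apply/is_trig_mxP => i k ik; rewrite mxE leqNgt ik.
Qed.

Lemma bigM_right_inverse :
  exists G : 'M[rat]_(m + n, n + r), ratmx M *m G = 1%:M.
Proof.
have [sel det0] := bigM_minor.
have uM : ratmx (colsub sel M) \in unitmx.
  by rewrite unitmxE unitfE det_map_mx intr_eq0.
exists (colsub sel 1%:M *m invmx (ratmx (colsub sel M))).
rewrite mulmxA mulmx_colsub mulmx1.
have -> : colsub sel (ratmx M) = ratmx (colsub sel M).
  by apply/matrixP => i j; rewrite !mxE.
exact: mulmxV.
Qed.

(** The first [n] coefficients are the vector [c] of the bijection [phi], the last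
    [r] ones the coordinates in the face [K]. *)
Lemma CK_rows (x : 'rV[rat]_(m + n)) :
  CK D (face F) x <-> exists2 c : 'rV[rat]_(n + r),
    forall i : 'I_r, (i.+1 < r)%N -> 0 <= c ord0 (rshift n i) & x = c *m ratmx M.
Proof.
have ME c c' : row_mx c c' *m ratmx M
    = row_mx (c' *m ratmx (EK F) + c *m ratmx D) (- c) :> 'rV[rat]_(m + n).
  rewrite /ratmx map_block_mx mul_row_block map_mx0 mulmx0 addr0.
  by rewrite map_mxN map_mx1 mulmxN mulmx1 addrC.
split=> [[v [c' [c'0 ->]] [c ->]]|[c c0 ->]].
  exists (row_mx c c'); last by rewrite ME.
  by move=> i ir; rewrite row_mxEr; exact: c'0.
exists (rsubmx c *m ratmx (EK F)).
  by exists (rsubmx c); split=> // i ir; rewrite mxE; exact: c0.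
by exists (lsubmx c); rewrite -ME hsubmxK.
Qed.

(** A right inverse of [M] recovers the coefficients on the rows from a point of
    the affine hull, and it is Lipschitz; the coefficients of a nearby point
    differ from those of [c] by less than [1]. *)
Lemma relint_CK (c : 'rV[rat]_(n + r)) :
  (forall i, 1 <= c ord0 i) -> relint (CK D (face F)) (c *m ratmx M).
Proof.
move=> c1; split.
  by apply/CK_rows; exists c => // i _; apply: le_trans (c1 _).
have [G MG] := bigM_right_inverse.
pose S := 1 + \sum_i \sum_j `|G i j|.
have S0 : 0 < S by rewrite ltr_wpDr // sumr_ge0 // => i _; rewrite sumr_ge0.
exists S^-1; first by rewrite invr_gt0.
move=> y [[s [sX _ yE]] ball].
apply/CK_rows; exists (y *m G); last first.
  rewrite yE !mulmx_suml big_seq [RHS]big_seq; apply: eq_bigr => cv scv.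
  have /CK_rows[a _ ->] := sX cv scv.
  by rewrite -!scalemxAl -(mulmxA a) MG mulmx1.
move=> i _; set k := rshift n i.
have -> : y *m G = c + (y - c *m ratmx M) *m G.
  by rewrite mulmxBl -mulmxA MG mulmx1 addrC subrK.
rewrite mxE -lerBlDr sub0r; apply: le_trans (c1 k); apply: le_trans (ler_norm _) _.
rewrite normrN mxE; apply: le_trans (ler_norm_sum _ _ _) _.
apply: (@le_trans _ _ (\sum_j S^-1 * `|G j k|)).
  apply: ler_sum => j _; rewrite normrM ler_wpM2r //; apply: ltW.
  by have := ball ord0 j; rewrite !mxE.
rewrite -mulr_sumr mulrC ler_pdivrMr // mul1r /S ler_wpDl //.
by apply: ler_sum => j _; rewrite (bigD1 k) //= lerDl sumr_ge0.
Qed.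
End FlagMatrix.

Lemma weight_rows (m n N : nat) (M : 'M[int]_(N, m + n)) (c : 'rV[rat]_N) e :
  weight (c *m ratmx M) e = (c *m ratmx (mval M e)) ord0 ord0.
Proof.
rewrite /mval /ratmx map_mxM mulmxA /weight mxE; apply: eq_bigr => i _.
by rewrite !mxE pmulrn.
Qed.

Section PrimeCone.
Context (C : fieldType) (n l m r : nat).
Context (A : 'M[C]_(l, m)) (D : 'M[int]_(n, m)) (F : 'I_r -> {set 'I_m}).
Hypothesis (F0 : forall i, F i != finset.set0).
Hypothesis (Flt : forall i j : 'I_r, (i < j)%N -> F i \proper F j).
Hypothesis (primeK : prime_cone (cox_ideal A D) (CK D (face F))).

(** Every combination of the rows of [M] with positive coefficients lies in the
    relative interior of [C_K], in particular those that refine the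
    lexicographic order. *)
Lemma prime_cone_degeneration : exists J : set {mpoly C[m + n]},
  [/\ lex_degeneration A D (bigM D F) J, prime_ideal J & forall e, ~ J 'X_[e]].
Proof.
have [inTrop eqJ primeJ] := primeK.
have w0 : relint (CK D (face F)) (const_mx 1 *m ratmx (bigM D F)).
  by apply: relint_CK => // i; rewrite mxE.
exists (in_ideal (const_mx 1 *m ratmx (bigM D F)) (cox_ideal A D)); split.
- move=> s; have [c c1 ltc] := lex_refining_weight [seq mval (bigM D F) e | e <- s].
  exists (c *m ratmx (bigM D F)); split.
  + by apply: eqJ => //; exact: relint_CK.
  + by move=> e f ef; rewrite !weight_rows ef.
  + by move=> e f se sf lt_ef; rewrite !weight_rows; apply: ltc; rewrite ?map_f.
- exact: primeJ.
- by move=> e Je; apply: (inTrop _ w0.1); exists e.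
Qed.
End PrimeCone.

(** * Sections and monomials *)

Lemma multinom_sum_vars m (y : 'X_{1..m}) :
  exists js : seq 'I_m, y = (\sum_(j <- js) U_(j))%MM.
Proof.
have [k] := ubnP (mdeg y); elim: k y => // k IHk y ltk.
have [y0|yn0] := eqVneq y 0%MM; first by exists [::]; rewrite big_nil.
have [j yj] : exists j, y j != 0%N.
  apply/existsP; apply: contraNT yn0; rewrite negb_exists => /forallP y0.
  by apply/eqP/mnmP => j; rewrite mnm0E; apply/eqP; rewrite -[_ == _]negbK.
have le_jy : (U_(j) <= y)%MM by rewrite lep1mP.
have [js jsE] : exists js : seq 'I_m, (y - U_(j))%MM = (\sum_(j <- js) U_(j))%MM.
  by apply: IHk; move: ltk; rewrite -{1}(submK le_jy) mdegD mdeg1 addn1 ltnS.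
by exists (j :: js); rewrite big_cons -jsE addmC submK.
Qed.

Section Sections.
Context (C : fieldType) (n d l m : nat).
Context (u : 'M[int]_(n, d)) (A : 'M[C]_(l, m)) (D : 'M[int]_(n, m)).
Local Notation Sym := (SymE A).
Implicit Types (p : {mpoly C[m + n]}) (e : 'X_{1..m + n}).

Lemma span_gen (G : set Sym) x : G x -> Defs.span G x.
Proof.
move=> Gx; exists [:: (1, x)]; split; last by rewrite big_seq1 mpolyC1 rmorph1 mul1r.
by move=> cg; rewrite inE => /eqP ->.
Qed.

Lemma toSymX_linform (j : 'I_m) :
  toSym A 'X_j = toSym A (linform (delta_mx ord0 j)).
Proof.
congr (toSym A _); rewrite /linform (bigD1 j) //= mxE !eqxx scale1r big1 ?addr0 //.
by move=> k kj; rewrite mxE (negbTE kj) andbF scale0r.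
Qed.

(** The monomials [X^a Y^b] are sections: the [X_i] enter with nonnegative
    exponents, which can only lower the order of vanishing asked of [Y^b]. *)
Lemma monomial_section e (alpha : 'rV[int]_n) (beta : int) (chi : 'rV[int]_d) :
    (mdeg (yexp e))%:Z = beta -> tdeg D e = chi *m u^T - alpha ->
  H0 u A D alpha beta (psi A D 'X_[e]).
Proof.
move=> be te w; rewrite psiX lcoef_mon.
have [<- _|_] := eqVneq (tdeg D e) w; last by rewrite eqxx.
have [js jsE] := multinom_sum_vars (yexp e).
have bjs : (size js)%:Z = beta.
  by rewrite -be jsE mdeg_sum (eq_bigr (fun=> 1%N)) ?sum1_size // => j _; rewrite mdeg1.
have XE : toSym A 'X_[yexp e] = \prod_(j <- js) toSym A 'X_j.
  by rewrite jsE -mprodXE rmorph_prod /=.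
split; first by exists chi.
  apply: span_gen; exists [seq toSym A 'X_j | j <- js].
  split; [by rewrite size_map| |by rewrite big_map].
  by move=> _ /mapP[j _ ->]; exists (delta_mx ord0 j); exact: toSymX_linform.
move=> i; apply: span_gen; exists [seq (D i j, toSym A 'X_j) | j <- js].
split; [by rewrite size_map| | |by rewrite big_map].
  move=> _ /mapP[j _ ->] /=; exists (delta_mx ord0 j); last exact: toSymX_linform.
  by move=> k; rewrite mxE eqxx /=; have [-> //|_] := eqVneq k j; rewrite eqxx.
rewrite big_map mxE lerBlDr ler_wpDr //.
suff -> : \sum_(j < m) D i j * (e (lshift n j))%:Z = \sum_(j <- js) D i j by [].
have eE j : e (lshift n j) = yexp e j by rewrite mnmE.
under eq_bigr do rewrite eE jsE mnm_sumE (big_morph Posz PoszD (erefl _)) mulr_sumr.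
rewrite exchange_big /=; apply: eq_bigr => k _.
rewrite (bigD1 k) //= mnm1E eqxx mulr1 big1 ?addr0 // => j jk.
by rewrite mnm1E eq_sym (negbTE jk) mulr0.
Qed.

Lemma monomial_cox e : cox u A D (psi A D 'X_[e]).
Proof.
exists [:: psi A D 'X_[e]]; split; last by rewrite big_seq1.
move=> g; rewrite inE => /eqP ->.
exists (- tdeg D e), (mdeg (yexp e))%:Z; apply: (monomial_section (chi := 0)) => //.
by rewrite mul0mx opprK add0r.
Qed.

Lemma H0_cox alpha beta f : H0 u A D alpha beta f -> cox u A D f.
Proof.
move=> Hf; exists [:: f]; rewrite big_seq1; split=> // g.
by rewrite inE => /eqP ->; exists alpha, beta.
Qed.

Lemma mdeg_linform_prod (cs : seq 'rV[C]_m) :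
  {in msupp (\prod_(c <- cs) linform c), forall y, mdeg y = size cs}.
Proof.
elim: cs => [|c cs IHcs] y.
  by rewrite big_nil msupp1 inE => /eqP ->; rewrite mdeg0.
rewrite big_cons => /msuppM_le /allpairsP[[y1 y2] /= [/mdeg_linform c1 /IHcs c2 ->]].
by rewrite mdegD c1 c2.
Qed.

Lemma sym_pow_homog (b : int) x : sym_pow b x ->
  exists2 h : {mpoly C[m]}, toSym A h = x & {in msupp h, forall y, (mdeg y)%:Z = b}.
Proof.
move=> [t [tP ->]]; elim: t tP => [|[c g] t IHt] tP.
  by exists 0; rewrite ?rmorph0 ?big_nil // => y; rewrite msupp0.
have [|h hE hb] := IHt; first by move=> cg tcg; apply: tP; rewrite inE tcg orbT.
have [/= es [esb esE ->]] := tP (c, g) (mem_head _ _).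
have [cs csE] : exists cs, es = [seq toSym A (linform c) | c <- cs].
  elim: es esE {esb} => [|e es IHes] esE; first by exists [::].
  have [|cs ->] := IHes; first by move=> e' ee'; apply: esE; rewrite inE ee' orbT.
  by have [a ->] := esE e (mem_head _ _); exists (a :: cs).
exists (c%:MP * \prod_(c <- cs) linform c + h).
  by rewrite big_cons rmorphD rmorphM rmorph_prod /= hE csE big_map.
move=> y /msuppD_le; rewrite mem_cat mul_mpolyC => /orP[|/hb //].
by move=> /msuppZ_le /mdeg_linform_prod ->; rewrite -esb csE size_map.
Qed.

(** The monomials of [p] that are not of the class [(alpha, beta)] cancel, since
    [L] is homogeneous. *)
Lemma section_homog p alpha beta :
    H0 u A D alpha beta (psi A D p) ->
  psi A D (mrestr (fun e => `[< exists chi, tdeg D e = chi *m u^T - alpha >]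
                            && ((mdeg (yexp e))%:Z == beta)) p) = psi A D p.
Proof.
move=> Hp; apply: laurentP => w.
pose t (v : 'rV[int]_n) (k : nat) :=
  `[< exists chi, v = chi *m u^T - alpha >] && (k%:Z == beta).
rewrite -[mrestr _ p]/(mrestr (fun e => t (tdeg D e) (mdeg (yexp e))) p).
rewrite [LHS]lcoef_psi [RHS]lcoef_psi (ypart_mrestr D t).
apply: subr0_eq; rewrite -rmorphB /=; apply/toSym_eq0.
have [y0|yn0] := eqVneq (lcoef (psi A D p) w) 0.
  move: y0; rewrite lcoef_psi => /toSym_eq0 y0.
  have yt := lin_ideal_homog (t w) y0.
  rewrite -mulN1r; apply: ideal_genD; [exact: yt | exact: ideal_genM].
have [exchi sp _] := Hp w yn0.
have twE k : t w k = (k%:Z == beta) by rewrite /t; case: asboolP.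
have [h hE hb] := sym_pow_homog sp; rewrite lcoef_psi in hE.
have yh : lin_ideal A (h - ypart D w p) by apply/toSym_eq0; rewrite rmorphB /= hE subrr.
have := lin_ideal_homog (t w) yh; rewrite raddfB /= [mrestr _ h]mrestr_id; last first.
  by move=> y /hb yb; rewrite twE yb.
move=> yh'; rewrite (_ : _ - _ = (h - ypart D w p)
    + (-1) * (h - mrestr (fun y => t w (mdeg y)) (ypart D w p))); last by ring.
by apply: ideal_genD; [exact: yh | apply: ideal_genM; exact: yh'].
Qed.
End Sections.

(** * Rational points of the polytope of a class *)

Section RationalPoints.

Lemma ratmx_inj p q : injective (@ratmx p q).
Proof.
move=> X Y /matrixP XY; apply/matrixP => i j.
by have := XY i j; rewrite !mxE => /intr_inj.
Qed.

Lemma common_denominator q (z : 'cV[rat]_q) :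
  exists2 k : nat, (0 < k)%N & exists a : 'cV[int]_q, k%:R *: z = ratmx a.
Proof.
pose k := (\prod_i `|denq (z i ord0)|)%N.
exists k; first by rewrite prodn_gt0 // => i; rewrite absz_gt0 denq_neq0.
have kz i : exists a : int, k%:R * z i ord0 = a%:~R.
  exists ((\prod_(j | j != i) `|denq (z j ord0)|)%N%:Z * numq (z i ord0)).
  rewrite intrM numqE /k (bigD1 i) //= natrM -mulrA mulrCA -pmulrn; congr (_ * _).
  by rewrite mulrC pmulrn absz_denq.
exists (\col_i projT1 (cid (kz i))); apply/colP => i; rewrite !mxE.
exact: (projT2 (cid (kz i))).
Qed.

Context (n d m : nat) (u : 'M[int]_(n, d)) (D : 'M[int]_(n, m)).
Implicit Types (e : 'X_{1..m + n}) (alpha : 'rV[int]_n).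

Lemma tdegE e : tdeg D e = (D *m usubmx (expv e) - dsubmx (expv e))^T.
Proof.
apply/rowP => i; rewrite !mxE; congr (_ - _).
by apply: eq_bigr => j _; rewrite !mxE.
Qed.

Lemma tdeg_class e alpha (chi : 'rV[int]_d) :
  tdeg D e = chi *m u^T - alpha <->
  ratmx D *m usubmx (ratmx (expv e)) + (ratmx alpha)^T - dsubmx (ratmx (expv e))
    = ratmx u *m (ratmx chi)^T.
Proof.
rewrite /ratmx -map_usubmx -map_dsubmx !matrix.map_trmx -!map_mxM -map_mxD -map_mxB.
rewrite -!/(ratmx _); split=> [te|/ratmx_inj te].
  congr ratmx; rewrite addrAC -[_ - _]trmxK -tdegE te raddfB /= trmx_mul trmxK.
  by rewrite subrK.
rewrite tdegE; apply: trmx_inj; rewrite trmxK raddfB /= trmx_mul trmxK -te.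
by rewrite addrAC addrK.
Qed.

Lemma mdeg_yexp e :
  \sum_(j < m) usubmx (ratmx (expv e)) j ord0 = (mdeg (yexp e))%:R :> rat.
Proof.
by rewrite mdegE natr_sum; apply: eq_bigr => j _; rewrite !mxE mnmE pmulrn.
Qed.

Lemma P_scale alpha (beta : int) (k : nat) (z : 'cV[rat]_(m + n)) : (0 < k)%N ->
  P u D (alpha *+ k) (beta *+ k) (k%:R *: z) <-> P u D alpha beta z.
Proof.
move=> k0; have k0r : 0 < k%:R :> rat by rewrite ltr0n.
have kn0 : k%:R != 0 :> rat by rewrite gt_eqF.
have alphaE : ratmx (alpha *+ k) = k%:R *: ratmx alpha.
  by apply/rowP => i; rewrite !mxE mulmxnE rmorphMn /= mulr_natl.
have lhsE : ratmx D *m usubmx (k%:R *: z) + (ratmx (alpha *+ k))^T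
      - dsubmx (k%:R *: z)
    = k%:R *: (ratmx D *m usubmx z + (ratmx alpha)^T - dsubmx z).
  by rewrite alphaE !linearZ /= -!scalerDr.
have sumE : \sum_(j < m) usubmx (k%:R *: z) j ord0
    = k%:R * \sum_(j < m) usubmx z j ord0.
  by rewrite mulr_sumr; apply: eq_bigr => j _; rewrite !mxE.
have betaE : (beta *+ k)%:~R = k%:R * beta%:~R :> rat by rewrite rmorphMn /= mulr_natl.
split=> -[/= z0 zb [chi zchi]].
  split=> [i||].
  - by have := z0 i; rewrite mxE pmulr_rge0.
  - by apply: (mulfI kn0); rewrite -sumE zb betaE.
  - exists (k%:R^-1 *: chi); apply: (scalerI kn0).
    by rewrite -lhsE zchi -scalemxAr scalerA mulfV // scale1r.
split=> [i||].
- by rewrite mxE mulr_ge0 // ltW.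
- by rewrite sumE zb betaE.
- by exists (k%:R *: chi); rewrite lhsE zchi scalemxAr.
Qed.

Lemma P_expv e alpha (beta : int) (chi : 'rV[int]_d) :
  (mdeg (yexp e))%:Z = beta -> tdeg D e = chi *m u^T - alpha ->
  P u D alpha beta (ratmx (expv e)).
Proof.
move=> eb /tdeg_class te; split=> [i||].
- by rewrite !mxE ler0z.
- by rewrite /= mdeg_yexp -eb pmulrn.
- by exists (ratmx chi)^T.
Qed.

(** A common denominator is taken for the point and for the character [chi] that
    witnesses its class, because the classes of monomials are integral. *)
Lemma P_integral_multiple alpha (beta : int) (z : 'cV[rat]_(m + n)) :
    P u D alpha beta z ->
  exists k e (chi : 'rV[int]_d),
    [/\ (0 < k)%N, k%:R *: z = ratmx (expv e), (mdeg (yexp e))%:Z = beta *+ k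
      & tdeg D e = chi *m u^T - alpha *+ k].
Proof.
move=> zP; have [/= z0 zb [chi zchi]] := zP.
have [k k0 [a ka]] := common_denominator (col_mx z chi).
have kz : k%:R *: z = ratmx (usubmx a).
  by rewrite /ratmx map_usubmx -/(ratmx a) -ka linearZ /= col_mxKu.
have kchi : k%:R *: chi = ratmx (dsubmx a).
  by rewrite /ratmx map_dsubmx -/(ratmx a) -ka linearZ /= col_mxKd.
pose e : 'X_{1..m + n} := [multinom `|usubmx a i ord0|%N | i < m + n].
have aE : usubmx a = expv e.
  apply/colP => i; rewrite [RHS]mxE mnmE gez0_abs //.
  have /(congr1 (fun x : 'cV_(m + n) => x i ord0)) := kz.
  rewrite mxE [ratmx _ i ord0]mxE => kzi.
  by rewrite -(ler0z rat) -kzi mulr_ge0.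
have zk : k%:R *: z = ratmx (expv e) by rewrite kz aE.
exists k, e, (dsubmx a)^T; split=> //.
  have [_ /= + _] := (P_scale alpha beta z k0).2 zP.
  by rewrite zk mdeg_yexp pmulrn => /intr_inj.
apply/tdeg_class; rewrite -zk.
have alphaE : ratmx (alpha *+ k) = k%:R *: ratmx alpha.
  by apply/rowP => i; rewrite !mxE mulmxnE rmorphMn /= mulr_natl.
rewrite alphaE !linearZ /= -!scalerDr zchi scalemxAr kchi.
by congr (_ *m _); apply/colP => i; rewrite !mxE.
Qed.

(** In the definition of [P alpha beta] only the character [chi] has no sign
    constraint; it is split into positive and negative parts. *)
Lemma P_polyhedron N (M : 'M[rat]_(N, m + n)) alpha (beta : int) :
  exists (B : 'M[rat]_(N, m + n + (d + d))) (E : 'M[rat]_(1 + n, m + n + (d + d))) h,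
    [set M *m z | z in P u D alpha beta] = polyhedron B E h.
Proof.
pose E : 'M[rat]_(1 + n, m + n + (d + d)) := col_mx
  (row_mx (row_mx (const_mx 1) 0) 0)
  (row_mx (row_mx (ratmx D) (- 1%:M)) (row_mx (- ratmx u) (ratmx u))).
pose h : 'cV[rat]_(1 + n) := col_mx (const_mx beta%:~R) (- (ratmx alpha)^T).
exists (row_mx M 0), E, h.
have Eh z (c c' : 'cV[rat]_d) : E *m col_mx z (col_mx c c') = h <->
    \sum_(j < m) usubmx z j ord0 = beta%:~R /\
    ratmx D *m usubmx z + (ratmx alpha)^T - dsubmx z = ratmx u *m (c - c').
  rewrite mul_col_mx !mul_row_col mul0mx addr0 -{1 2}[z]vsubmxK !mul_row_col mul0mx.
  rewrite addr0 !mulNmx mul1mx mulmxBr; split=> [/eq_col_mx[zb zchi]|[zb zchi]].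
    split.
      move/(congr1 (fun x : 'cV_1 => x ord0 ord0)): zb; rewrite !mxE => <-.
      by apply: eq_bigr => j _; rewrite [const_mx 1 _ _]mxE mul1r.
    apply/colP => i; move/(congr1 (fun x : 'cV_n => x i ord0)): zchi.
    by rewrite !mxE; lra.
  congr col_mx.
    apply/colP => i; rewrite ord1 !mxE -zb.
    by apply: eq_bigr => j _; rewrite [const_mx 1 _ _]mxE mul1r.
  apply/colP => i; move/(congr1 (fun x : 'cV_n => x i ord0)): zchi.
  by rewrite !mxE; lra.
rewrite eqEsubset; split=> [_ [z [/= z0 zb [chi zchi]] <-]|_ [z' [z'0 Ez'] <-]].
  pose c : 'cV[rat]_d := \col_i Num.max (chi i ord0) 0.
  pose c' : 'cV[rat]_d := \col_i Num.max (- chi i ord0) 0.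
  exists (col_mx z (col_mx c c')); last by rewrite mul_row_col mul0mx addr0.
  split.
    move=> i; rewrite mxE; case: splitP => j _; first exact: z0.
    by rewrite mxE; case: splitP => k _; rewrite mxE le_max lexx orbT.
  apply/Eh; split=> //; rewrite zchi; congr (_ *m _); apply/colP => i.
  by rewrite !mxE /Num.max; case: ltP => ?; case: ltP => ?; lra.
move: Ez'; rewrite -[z']vsubmxK -[dsubmx z']vsubmxK => /Eh[zb zchi].
exists (usubmx z'); last by rewrite mul_row_col mul0mx addr0.
split=> [i||] /=; [by rewrite mxE; exact: z'0 | exact: zb |].
by exists (usubmx (dsubmx z') - dsubmx (dsubmx z')).
Qed.
End RationalPoints.

(** * The Newton-Okounkov bodies *)

Section Bodies.
Context (C : fieldType) (n d l m N : nat).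
Context (u : 'M[int]_(n, d)) (A : 'M[C]_(l, m)) (D : 'M[int]_(n, m)).
Context (M : 'M[int]_(N, m + n)) (J : set {mpoly C[m + n]}).
Hypothesis (degJ : lex_degeneration A D M J) (primeJ : prime_ideal J).
Hypothesis (monJ : forall e, ~ J 'X_[e]).
Hypothesis (genXY : generated_by_XY u A D).
Implicit Types (f g : laurent (SymE A) n) (e : 'X_{1..m + n}).
Local Notation v := (val_M A D M).
Local Notation R := (cox u A D).

Lemma adapted_monomial e : adapted M J 'X_[e] (mval M e).
Proof.
split=> [e'|]; first by rewrite msuppX inE => /eqP ->; exact: lexle_refl.
by rewrite /lex_part mrestrX eqxx; exact: monJ.
Qed.

Lemma psi_monomial_neq0 e : psi A D 'X_[e] != 0.
Proof. exact: (adapted_neq0 degJ (adapted_monomial e)). Qed.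

Lemma val_monomial e : v (psi A D 'X_[e]) = mval M e.
Proof. exact: (val_M_eq degJ (adapted_monomial e)). Qed.

Lemma mval_var k : mval M U_(k) = col k M.
Proof.
apply/colP => i; rewrite !mxE (bigD1 k) //= mxE mnm1E eqxx mulr1 big1 ?addr0 //.
by move=> j jk; rewrite mxE mnm1E eq_sym (negbTE jk) mulr0.
Qed.

Lemma cox_adapted f : R f -> f != 0 ->
  exists2 p, psi A D p = f & adapted M J p (v f).
Proof. by move=> /genXY fp f0; exact: (val_M_adapted degJ f0 fp). Qed.

Lemma cox_is_val f : R f -> f != 0 -> is_val A D M f (v f).
Proof. by move=> Rf f0; have [p <- /(adapted_is_val degJ)] := cox_adapted Rf f0. Qed.

Lemma cox_val_mval f : R f -> f != 0 -> exists e, v f = mval M e.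
Proof.
move=> Rf f0; have [p _ /(adapted_min degJ)[[e _ ->] _]] := cox_adapted Rf f0.
by exists e.
Qed.

Lemma val_cst c : c != 0 -> v (cst n A c) = 0.
Proof.
move=> c0; have -> : cst n A c = psi A D c%:MP by rewrite /psi mmapC.
apply: (val_M_eq degJ); have mval0 : mval M 0%MM = 0.
  by rewrite /mval (_ : expv 0 = 0) ?mulmx0 //; apply/colP => i; rewrite !mxE mnm0E.
split=> [e|].
  rewrite msuppC (negbTE c0) inE => /eqP ->; rewrite mval0; exact: lexle_refl.
rewrite /lex_part mrestr_id; last first.
  by move=> e; rewrite msuppC (negbTE c0) inE => /eqP ->; rewrite mval0.
move=> /(degenerationM degJ c^-1%:MP); rewrite -mpolyCM mulVf // mpolyC1.
exact: primeJ.1.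
Qed.

Lemma valM f g : R f -> R g -> f != 0 -> g != 0 -> f * g != 0 /\ v (f * g) = v f + v g.
Proof.
move=> Rf Rg f0 g0; have [p pf pa] := cox_adapted Rf f0.
have [q qg qa] := cox_adapted Rg g0; have pqa := adaptedM primeJ pa qa.
have -> : f * g = psi A D (p * q) by rewrite rmorphM /= pf qg.
split; first exact: (adapted_neq0 degJ pqa).
exact: (val_M_eq degJ pqa).
Qed.

Lemma valD f g : R f -> R g -> f != 0 -> g != 0 -> f + g != 0 ->
  lexle (v f) (v (f + g)) || lexle (v g) (v (f + g)).
Proof.
move=> Rf Rg f0 g0 fg0; have [p pf [px _]] := cox_adapted Rf f0.
have [q qg [qx _]] := cox_adapted Rg g0.
have fgE : psi A D (p + q) = f + g by rewrite rmorphD /= pf qg.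
have [r rfg /(adapted_is_val degJ)] : exists2 r, psi A D r = f + g
    & adapted M J r (v (f + g)).
  by apply: (val_M_adapted degJ) => //; exists (p + q).
rewrite rfg => -[_ vmax].
have [|y pqy] := @min_value_exists _ _ _ _ M (p + q).
  by apply: contraNneq fg0 => pq0; rewrite -fgE pq0 rmorph0.
have yv := vmax _ _ fgE pqy; have [[e pqe yE] _] := pqy.
move: pqe => /msuppD_le; rewrite mem_cat => /orP[/px|/qx];
  by rewrite /mval -yE => /lexle_trans /(_ yv) ->; rewrite ?orbT.
Qed.

Local Notation MQ z := (ratmx M *m z).

Lemma ratmx_mval e : ratmx (mval M e) = MQ (ratmx (expv e)).
Proof. by rewrite /ratmx map_mxM. Qed.

Lemma global_NO_body_cone :
  [set MQ z | z in [set z : 'cV[rat]_(m + n) | forall k, 0 <= z k ord0]]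
    = global_NO_body R v.
Proof.
pose K := polyhedron (ratmx M) (0 : 'M[rat]_(0, m + n)) 0.
have -> : [set MQ z | z in [set z : 'cV[rat]_(m + n) | forall k, 0 <= z k ord0]] = K.
  rewrite eqEsubset; split=> [_ [z z0 <-]|_ [z [z0 _] <-]]; last by exists z.
  by exists z => //; split=> //; exact: flatmx0.
rewrite eqEsubset; split=> [_ [z [z0 _] <-]|].
  apply: sub_Qclosure.
  exists [seq (z k ord0, ratmx (v (psi A D 'X_k))) | k <- enum 'I_(m + n)].
  split=> [_ /mapP[k _ ->] /=|].
    split; first exact: z0.
    exists (psi A D 'X_k) => //; split; first exact: monomial_cox.
    by apply/eqP; exact: psi_monomial_neq0.
  rewrite big_map big_enum /=; apply/colP => i; rewrite mxE summxE.
  by apply: eq_bigr => k _; rewrite val_monomial mval_var !mxE mulrC.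
apply: subset_trans (@Qclosure_polyhedron _ _ _ _ _ _).
apply: QclosureS; apply: subset_trans (@cone_hull_polyhedron _ _ _ _ _).
apply: cone_hullS => _ [f [Rf /eqP f0] <-].
have [e ->] := cox_val_mval Rf f0; rewrite ratmx_mval.
by exists (ratmx (expv e)) => //; split=> [i|]; [rewrite !mxE ler0z | exact: flatmx0].
Qed.

(** Restriction to the monomials of the class can only raise the minimum of an
    adapted representative, and that minimum is already the largest possible. *)
Lemma section_val alpha beta f : H0 u A D alpha beta f -> f != 0 ->
  exists e (chi : 'rV[int]_d), [/\ v f = mval M e, (mdeg (yexp e))%:Z = beta
    & tdeg D e = chi *m u^T - alpha].
Proof.
move=> Hf f0; have Rf := H0_cox Hf.
have [p pf pa] := cox_adapted Rf f0; rewrite -pf in Hf.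
have := section_homog Hf; set T := (fun e => _) => qp.
have [_ vmax] := adapted_is_val degJ pa; have [_ px] := adapted_min degJ pa.
have [|y qy] := @min_value_exists _ _ _ _ M (mrestr T p).
  by apply: contraNneq f0 => q0; rewrite -pf -qp q0 rmorph0.
have yv := vmax _ _ qp qy; have [[e + yE] _] := qy.
rewrite msupp_mrestr => /andP[/andP[/asboolP[chi te] /eqP be] pe].
exists e, chi; split; [|exact: be|exact: te].
by rewrite /mval -yE; apply: lexle_anti yv; rewrite yE; exact: px.
Qed.

Lemma NO_body_image alpha beta :
  [set MQ z | z in P u D alpha beta]
    = NO_body (fun k => H0 u A D (alpha *+ k) (beta *+ k)) v.
Proof.
rewrite eqEsubset; split=> [_ [z zP <-]|].
  apply/sub_Qclosure/sub_conv_hull.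
  have [k [e [chi [k0 kz be te]]]] := P_integral_multiple zP.
  exists k, (psi A D 'X_[e]); split=> //.
  - exact: monomial_section be te.
  - by apply/eqP; exact: psi_monomial_neq0.
  - rewrite val_monomial ratmx_mval -kz -scalemxAr scalerA mulVf ?scale1r //.
    by rewrite pnatr_eq0 -lt0n.
have [B [E [h PE]]] := P_polyhedron u D (ratmx M) alpha beta; rewrite PE.
apply: subset_trans (@Qclosure_polyhedron _ _ _ B E h).
apply: QclosureS; apply: subset_trans (@conv_hull_polyhedron _ _ _ B E h).
apply: conv_hullS => _ [k [f [k0 Hf /eqP f0 ->]]]; rewrite -PE.
have [e [chi [-> be te]]] := section_val Hf f0.
exists (k%:R^-1 *: ratmx (expv e)); last by rewrite ratmx_mval scalemxAr.
apply/(P_scale _ _ _ _ _ k0); rewrite scalerA mulfV ?scale1r; first exact: P_expv be te.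
by rewrite pnatr_eq0 -lt0n.
Qed.
End Bodies.

Theorem theorem1p1 (R : realType) (n d l m r : nat)
    (u : 'M[int]_(n, d)) (Sigma : {set {set 'I_n}})
    (A : 'M[R[i]]_(l, m)) (D : 'M[int]_(n, m)) (F : 'I_r -> {set 'I_m})
    (fanS : is_fan u Sigma) (smoothS : smooth_fan u Sigma)
    (completeS : complete_fan u Sigma) (projectiveS : projective_fan u Sigma)
    (rankE : dimE A = r) (r_ge2 : (2 <= r)%N)
    (diagramD : diagram A D Sigma)
    (gen1 : generated_in_sym_degree1 u A D)
    (genXY : generated_by_XY u A D)
    (flagF : maximal_flag A F)
    (primeK : prime_cone (cox_ideal A D) (CK D (face F))) :
  let M := bigM D F in
  let MQ (z : 'cV[rat]_(m + n)) : 'cV[rat]_(n + r) := ratmx M *m z in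
  let v := val_M A D M in
  [/\ (forall f, cox u A D f -> f != 0 -> is_val A D M f (v f))
      /\ full_rank_valuation (cst n A) (cox u A D) v,
      [set MQ z | z in [set z : 'cV[rat]_(m + n) | forall k, 0 <= z k ord0]]
        = global_NO_body (cox u A D) v
    & forall (alpha : 'rV[int]_n) (beta : int),
        [set MQ z | z in P u D alpha beta]
          = NO_body (fun k => H0 u A D (alpha *+ k) (beta *+ k)) v].
Proof.
move=> M MQ v; have [/all_and2[_ F0] Flt _ _] := flagF.
have [J [degJ primeJ monJ]] := prime_cone_degeneration F0 Flt primeK.
split; [split| |].
- by move=> f; exact: cox_is_val degJ genXY f.
- split.
  + exact: val_cst degJ primeJ.
  + exact: valM degJ primeJ genXY.
  + exact: valD degJ genXY.
  + have [sel sel0] := bigM_minor D F0 Flt.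
    exists (fun j => psi A D 'X_(sel j)); split.
      by move=> j; split; [exact: monomial_cox | exact: psi_monomial_neq0 degJ monJ _].
    rewrite (_ : \matrix_(i, j) _ = colsub sel M) //.
    apply/matrixP => i j; rewrite [LHS]mxE [RHS]mxE /v (val_monomial degJ monJ).
    by rewrite mval_var [LHS]mxE.
- exact: global_NO_body_cone degJ monJ genXY.
- exact: NO_body_image degJ monJ genXY.
Qed.
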